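(* Assume that $P_X \ll \nu$, where $\nu(dx)=\nu_1(dx_1)\otimes\cdots\otimes\nu_p(dx_p)$, and that there exists $0<M\le 1$ such that for every $u\subseteq \{1,\dots,p\}$, $p_X \ge M\, p_{X_u}p_{X_{u^c}}$ $\nu$-a.e. Let $\eta\in L^2_{\mathbb R}(\mathbb R^p,\mathcal B(\mathbb R^p),P_X)$ and $Y=\eta(\mathbf X)$. Let $(\mathcal P)$ be the problem of minimizing $$\mathbb E\Big[\Big(Y-\sum_{u\in S}\tilde\eta_u(X_u)\Big)^2\Big]$$ over families $(\tilde\eta_u)_{u\in S}$ with $\tilde\eta_u\in H_u$ for all $u \in S$, subject to the constraints $$\mathbb E\big(\tilde\eta_u(X_u)\mid X_{u\setminus\{i\}}\big)=0\qquad \forall i\in u,\ \forall u\in S\setminus\{\emptyset\}.$$ Then $(\mathcal P)$ admits a unique solution $\eta^*=(\eta_u)_{u\in S}$, where $(\eta_u)_{u\in S}$ are the components of the hierarchically orthogonal decomposition of $\eta$.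
   Context: Let $(\Omega,\mathcal A,P)$ be a probability space, $p\ge 1$, $\mathbf X=(X_1,\dots,X_p)$ a random vector in $\mathbb R^p$ with law $P_X$. $\nu$ is a $\sigma$-finite measure on $(\mathbb R^p,\mathcal B(\mathbb R^p))$ and $p_X=dP_X/d\nu$. $S$ is the collection of all subsets of $\{1,\dots,p\}$. For $u\in S$, $X_u=(X_l)_{l\in u}$, $u^c$ is the complement of $u$ in $\{1,\dots,p\}$, and $p_{X_u}$ is the marginal density of $X_u$ with respect to $\bigotimes_{l\in u}\nu_l$ (with $p_{X_\emptyset}=1$). Conditioning on $X_\emptyset$ means taking the plain expectation. The inner product of $L^2_{\mathbb R}(\mathbb R^p,\mathcal B(\mathbb R^p),P_X)$ is $\langle h_1,h_2\rangle=\mathbb E(h_1(\mathbf X)h_2(\mathbf X))$. Functions are identified when equal $P_X$-a.s. $H_u$ is the subspace of square integrable measurable functions depending only on $X_u$; $H_\emptyset$ is the set of constants and $H_\emptyset^0=H_\emptyset$. For $u\in S\setminus\{\emptyset\}$, recursively, $$H_u^0=\{h_u(X_u)\in H_u:\ \langle h_u,h_v\rangle=0\ \ \forall v\subset u,\ \forall h_v\in H_v^0\},$$ where $\subset$ denotes strict inclusion. Hierarchically orthogonal decomposition: under the assumptions of the claim there is a unique family $(\eta_u)_{u\in S}$ with $\eta_u\in H_u^0$ for all $u\in S$ and $\eta(\mathbf X)=\sum_{u\in S}\eta_u(X_u)$; its members are the components referred to in the claim. *)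

(* Defs.v *)
From HB Require Import structures.
From mathcomp Require Import all_boot all_order all_algebra.
From mathcomp Require Import all_classical all_reals all_analysis.

Set Implicit Arguments.
Unset Strict Implicit.
Unset Printing Implicit Defensive.
Import Order.TTheory GRing.Theory Num.Theory.
Import numFieldNormedType.Exports.

Local Open Scope classical_set_scope.
Local Open Scope ring_scope.

Section tuple_measure.
Context {R : realType}.
Local Open Scope ereal_scope.

Definition pair_cons n (xt : R * n.-tuple R) : n.+1.-tuple R :=
  [tuple of xt.1 :: xt.2].

Lemma measurable_pair_cons n : measurable_fun setT (@pair_cons n).
Proof. exact: measurable_cons measurable_fst measurable_snd. Qed.

HB.instance Definition _ n :=
  isMeasurableFun.Build _ _ _ _ (@pair_cons n) (@measurable_pair_cons n).

Section cons_measure.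
Variables (n : nat) (m1 : {sigma_finite_measure set R -> \bar R})
  (m2 : {sigma_finite_measure set (n.-tuple R) -> \bar R}).

Definition cons_measure : set (n.+1.-tuple R) -> \bar R :=
  pushforward (m1 \x m2) (@pair_cons n).

Let cons_measure0 : cons_measure set0 = 0.
Proof. exact: measure0. Qed.

Let cons_measure_ge0 A : 0 <= cons_measure A.
Proof. exact: measure_ge0. Qed.

Let cons_measure_sigma_additive : semi_sigma_additive cons_measure.
Proof. exact: measure_semi_sigma_additive. Qed.

HB.instance Definition _ := isMeasure.Build _ _ _ cons_measure
  cons_measure0 cons_measure_ge0 cons_measure_sigma_additive.

Let cons_measure_sigma_finite : sigma_finite setT cons_measure.
Proof.
have /sigma_finiteP[F [FT ndF Foo]] := sigma_finiteT m1.
have /sigma_finiteP[G [GT ndG Goo]] := sigma_finiteT m2.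
pose g (x : n.+1.-tuple R) : R * n.-tuple R := (thead x, [tuple of behead x]).
have mg : measurable_fun setT g.
  apply: measurable_fun_pair; last exact: measurable_behead.
  exact: (measurable_tnth ord0).
have gK : cancel (@pair_cons n) g.
  move=> [x t]; rewrite /g /pair_cons/= theadE; congr (_, _).
  exact: val_inj.
have FGT : \bigcup_k (F k `*` G k) = setT.
  rewrite -subTset => -[x t] _.
  have [i _ Fx] : (\bigcup_k F k) x by rewrite -FT.
  have [j _ Gt] : (\bigcup_k G k) t by rewrite -GT.
  exists (maxn i j) => //; split.
    by move: x Fx; exact/subsetPset/ndF/leq_maxl.
  by move: t Gt; exact/subsetPset/ndG/leq_maxr.
exists (fun k => g @^-1` (F k `*` G k)).
  by rewrite -preimage_bigcup FGT preimage_setT.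
move=> k; have [mF Fk] := Foo k; have [mG Gk] := Goo k; split.
  by rewrite -[_ @^-1` _]setTI; apply: mg => //; exact: measurableX.
rewrite /cons_measure /pushforward -comp_preimage.
rewrite (_ : g \o _ = id); last by apply/funext => x; exact: gK.
by rewrite preimage_id product_measure1E// lte_mul_pinfty// ge0_fin_numE.
Qed.

HB.instance Definition _ :=
  Measure_isSigmaFinite.Build _ _ _ cons_measure cons_measure_sigma_finite.

End cons_measure.

Fixpoint prod_measure n :
    ('I_n -> {sigma_finite_measure set R -> \bar R}) ->
    {sigma_finite_measure set (n.-tuple R) -> \bar R} :=
  match n with
  | 0 => fun=> dirac [tuple]
  | n'.+1 => fun nu =>
      cons_measure (nu ord0) (prod_measure (fun i => nu (lift ord0 i)))
  end.

Lemma prod_measure_box n (nu : 'I_n -> {sigma_finite_measure set R -> \bar R})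
    (A : 'I_n -> set R) : (forall i, measurable (A i)) ->
  prod_measure nu [set x | forall i, A i (tnth x i)] = \prod_(i < n) nu i (A i).
Proof.
elim: n nu A => [|n IH] nu A mA.
  by rewrite big_ord0/= diracE mem_set//= => -[].
rewrite big_ord_recl -(IH (nu \o lift ord0) (A \o lift ord0)); last first.
  by move=> i; exact: mA.
rewrite /= /cons_measure /pushforward.
rewrite -product_measure1E//; last first.
  rewrite (_ : mkset _ = \bigcap_i ((tnth (T:=R))^~ i @^-1` A (lift ord0 i))).
    apply: fin_bigcap_measurable => [|i _]; first exact: finite_finset.
    by rewrite -[_ @^-1` _]setTI; exact: measurable_tnth.
  by apply/seteqP; split => x /= Ax i; [move=> _; exact: Ax|exact: Ax].
congr (_ _); apply/seteqP; split => -[x t]/=.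
  move=> Axt; split; first exact: (Axt ord0).
  by move=> i; have := Axt (lift ord0 i); rewrite tnthS.
move=> [Ax At] i; case: (unliftP ord0 i) => [j|] ->; last exact: Ax.
by rewrite tnthS; exact: At.
Qed.

End tuple_measure.

Section projection.
Context {R : realType} {p : nat}.

(* x_u, with the coordinates listed in the increasing order of the indices *)
Definition subvect (u : {set 'I_p}) (x : p.-tuple R) : #|u|.-tuple R :=
  [tuple tnth x (enum_val k) | k < #|u|].

Lemma measurable_subvect (u : {set 'I_p}) : measurable_fun setT (subvect u).
Proof.
apply/measurable_fun_tnthP => k; rewrite (_ : _ \o _ = @tnth p R ^~ (enum_val k)).
  exact: measurable_tnth.
by apply/funext => x /=; rewrite tnth_mktuple.
Qed.

HB.instance Definition _ (u : {set 'I_p}) :=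
  isMeasurableFun.Build _ _ _ _ (subvect u) (@measurable_subvect u).

End projection.

Arguments subvect {R p} u x.

Section conditional_expectation.
Context {d d'} {T : measurableType d} {T' : measurableType d'} {R : realType}.
Variable P : probability T R.

(* W is a version of E(Z | V); [preimage_set_system setT V measurable] is the
   sigma-algebra generated by V. When V takes values in [0.-tuple R] this
   sigma-algebra is trivial and E(Z | V) is the expectation of Z. *)
Definition is_cond_expectation (V : {mfun T >-> T'}) (Z W : T -> R) : Prop :=
  [/\ P.-integrable setT (EFin \o Z),
      P.-integrable setT (EFin \o W),
      (forall B, measurable B ->
         preimage_set_system setT V measurable (W @^-1` B)) &
      (forall A, preimage_set_system setT V measurable A ->
         (\int[P]_(w in A) (W w)%:E = \int[P]_(w in A) (Z w)%:E)%E)].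

End conditional_expectation.

Section density.
Local Open Scope charge_scope.
Context {d} {T : measurableType d} {R : realType} (P : probability T R).

Definition density n (nu : 'I_n -> {sigma_finite_measure set R -> \bar R})
    (Z : {mfun T >-> n.-tuple R}) : n.-tuple R -> \bar R :=
  'd (charge_of_finite_measure (distribution P Z)) '/d (prod_measure nu).

(* If the law of X is dominated by [prod_measure nu], then the law of X_u is
   dominated by the product of the nu_l, l in u. *)
Definition marginal_density p
    (nu : 'I_p -> {sigma_finite_measure set R -> \bar R})
    (X : {mfun T >-> p.-tuple R}) (u : {set 'I_p}) : #|u|.-tuple R -> \bar R :=
  density (nu \o enum_val) (subvect u \o X).

Arguments marginal_density {p} nu X u.

Lemma density0 n (nu : 'I_n -> {sigma_finite_measure set R -> \bar R})
    (Z : {mfun T >-> n.-tuple R}) x : n = 0%N -> density nu Z x = 1%E.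
Proof.
move=> n0; subst n.
have PnuZ : distribution P Z `<< prod_measure nu.
  apply/null_content_dominatesP => A mA /=.
  have [->|/set0P[y Ay]] := eqVneq A set0; first by rewrite !measure0.
  rewrite diracE mem_set ?(tuple0 y)//; first by move/eqP; rewrite onee_eq0.
  by rewrite -(tuple0 y).
have := Radon_Nikodym_integral
  (nu := charge_of_finite_measure (distribution P Z)) PnuZ measurableT.
rewrite /= probability_setT integral_dirac//.
  by rewrite diracT mul1e (tuple0 x).
Qed.

Lemma marginal_density_set0 p
  (nu : 'I_p -> {sigma_finite_measure set R -> \bar R}) (X : {mfun T >-> p.-tuple R}) x :
  marginal_density nu X finset.set0 x = 1%E.
Proof. by apply: density0; rewrite cards0. Qed.

End density.

Arguments marginal_density {d T R} P {p} nu X u.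

Section decomposition.
Context {d} {T : measurableType d} {R : realType} (P : probability T R).
Context {p : nat} (X : {mfun T >-> p.-tuple R}).

Definition inner (h1 h2 : p.-tuple R -> R) : \bar R :=
  'E_P[fun w => h1 (X w) * h2 (X w)].

Definition H (u : {set 'I_p}) : set (p.-tuple R -> R) :=
  [set h | h \in Lfun (distribution P X) 2%:E /\
    exists2 g : #|u|.-tuple R -> R, measurable_fun setT g & h = g \o subvect u].

(* The recursion on strict inclusion is driven by a bound [n] on #|u|; see [H0E]
   for the defining equation. *)
Fixpoint H0_rec (n : nat) (u : {set 'I_p}) : set (p.-tuple R -> R) :=
  if n is n'.+1 then
    [set h | H u h /\ forall v : {set 'I_p}, v \proper u ->
      forall g, H0_rec n' v g -> inner h g = 0%E]
  else H u.

Definition H0 (u : {set 'I_p}) : set (p.-tuple R -> R) := H0_rec #|u| u.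

Lemma H0_recE n (u : {set 'I_p}) : (#|u| <= n)%N -> H0_rec n u = H0 u.
Proof.
rewrite /H0; have [m] := ubnP n; elim: m n u => // m IH [|n] u nm un.
  by move: un; rewrite leqn0 => /eqP ->.
case cu : #|u| => [|k]; apply/seteqP; split=> h //=.
- by case.
- move=> Hh; split=> // v; rewrite (cards0_eq cu) => vu.
  by have := proper_card vu; rewrite cards0.
- move=> [Hh hu]; split=> // v vu g.
  have vk : (#|v| <= k)%N by rewrite -ltnS -cu proper_card.
  rewrite IH//; last by rewrite cu ltnS in un; exact: leq_ltn_trans un _.
  move=> gv; apply: (hu _ vu); rewrite IH//.
  by rewrite (leq_trans vk)// -ltnS -cu.
- move=> [Hh hu]; split=> // v vu g.
  have vk : (#|v| <= k)%N by rewrite -ltnS -cu proper_card.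
  rewrite IH//; last by rewrite (leq_trans vk)// -ltnS -cu.
  move=> gv; apply: (hu _ vu); rewrite IH//.
  by rewrite cu ltnS in un; exact: leq_ltn_trans un _.
Qed.

Lemma H0_set0 : H0 finset.set0 = H finset.set0.
Proof. by rewrite /H0 cards0. Qed.

Lemma H0E (u : {set 'I_p}) : H0 u =
  [set h | H u h /\ forall v : {set 'I_p}, v \proper u ->
    forall g, H0 v g -> inner h g = 0%E].
Proof.
rewrite -(@H0_recE #|u|.+1)//=; apply/seteqP; split=> h [Hh hu]; split=> // v vu g.
  by move=> gv; apply: (hu _ vu); rewrite H0_recE// ltnW// proper_card.
by move=> gv; apply: (hu _ vu); rewrite -(@H0_recE #|u|)// ltnW// proper_card.
Qed.

Definition hierarchical_decomposition (eta : p.-tuple R -> R)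
    (e : {set 'I_p} -> p.-tuple R -> R) : Prop :=
  (forall u, H0 u (e u)) /\
  \forall w \ae P, eta (X w) = \sum_(u : {set 'I_p}) e u (X w).

Definition feasible (e : {set 'I_p} -> p.-tuple R -> R) : Prop :=
  (forall u, H u (e u)) /\
  forall u : {set 'I_p}, u != finset.set0 -> forall i, i \in u ->
    is_cond_expectation P (subvect (u :\ i) \o X) (e u \o X) (cst 0).

Definition objective (eta : p.-tuple R -> R)
    (e : {set 'I_p} -> p.-tuple R -> R) : \bar R :=
  'E_P[fun w => (eta (X w) - \sum_(u : {set 'I_p}) e u (X w)) ^+ 2].

Definition solution (eta : p.-tuple R -> R)
    (e : {set 'I_p} -> p.-tuple R -> R) : Prop :=
  feasible e /\
  forall e', feasible e' -> (objective eta e <= objective eta e')%E.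

Definition eq_family (e e' : {set 'I_p} -> p.-tuple R -> R) : Prop :=
  forall u, e u = e' u %[ae distribution P X].

End decomposition.

(* Main.v *)
Require Import Defs.
From HB Require Import structures.
From mathcomp Require Import all_boot all_order all_algebra.
From mathcomp Require Import all_classical all_reals all_analysis.
From mathcomp Require Import measurable_realfun ring lra.
Import Order.TTheory GRing.Theory Num.Theory.
Import numFieldNormedType.Exports.
Local Open Scope classical_set_scope.
Local Open Scope ring_scope.

Set Implicit Arguments.
Unset Strict Implicit.
Unset Printing Implicit Defensive.

(** The proof rests on one inequality between measures.  Write [mu] for the law of
    [X] and [merge u x y] for the vector with the coordinates of [x] in [u] and
    those of [y] outside [u].  The lower bound on the density says that [mu]
    dominates [M] times the law obtained by drawing the coordinates in [u] and
    those outside [u] independently: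
      [M * \int_y \int_x f (merge u x y) <= \int_x f x]  for every [f >= 0]
    ([merge_integral_le]).

    Let [orthH u] be the space of the functions in [H u] that are orthogonal to
    [H v] for all [v] strictly included in [u].  Take [h] in [orthH u], and a sum
    [g] of functions of subvectors [X_v] where no [v] contains [u].  For almost every [y],
    [x |-> g (merge u x y)] is a sum of functions of the subvectors of indices
    [u :&: v], all strictly included in [u], so that it is orthogonal to [h]; by
    Pythagoras its inner integral with [h] added is at least [||h||^2], and the
    measure inequality gives [M * ||h||^2 <= ||h + g||^2] ([orthH_lower_bound]).
    Removing one by one the members of largest index set from a sum of elements of
    the [orthH v], one finds [c > 0] with
      [c * \sum_v ||e v||^2 <= ||\sum_v e v||^2]  ([orthH_stable]).

    This makes the sum of the [orthH v] direct, whence all the uniqueness claims,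
    and complete, because the members of a Cauchy sequence of sums are then Cauchy.
    A function in [H u] can hence be projected on the sum of the [orthH v] with [v]
    strictly included in [u]; this sum is the sum of the [H v] by induction, so that
    the remainder lies in [orthH u] ([H_decomposition]).  It follows that [orthH u]
    is the space [H0 u] ([H0_orthH]).

    Finally [E(h(X) | X_w) = 0] says that [h] is orthogonal to [H w]
    ([cond_expectation0P]), and every strict subset of [u] lies in some [u :\ i].
    Hence the constraints of the minimization problem say that each member of the
    family is in [orthH u].  The decomposition is feasible with objective [0], and a
    feasible family with objective [0] is a decomposition. *)

(** * Square-integrable functions *)

Lemma le0_of_le_geometric (R : realType) (x C : R) :
  (forall n, x <= C * (4^-1) ^+ n) -> x <= 0.
Proof.
move=> xC.
have cC : C * (4^-1) ^+ n @[n --> \oo] --> (0 : R).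
  rewrite -[X in _ --> X](mulr0 C); apply: cvgMr.
  by apply: cvg_expr; rewrite ger0_norm ?invr_ge0// invf_lt1//; lra.
rewrite -(cvg_lim _ cC)//; apply: limr_ge; first by apply/cvg_ex; exists 0.
by apply: nearW.
Qed.

Lemma discriminant_le (R : realFieldType) (a b c : R) :
  0 <= a -> 0 <= c ->
  (forall t, 0 <= a + 2 * t * b + t ^+ 2 * c) -> b ^+ 2 <= a * c.
Proof.
move=> a0 c0 abc; have [c_gt0|] := ltP 0 c.
  have := abc (- (b / c)).
  rewrite -(pmulr_rge0 _ c_gt0).
  have -> : c * (a + 2 * - (b / c) * b + (- (b / c)) ^+ 2 * c) = a * c - b ^+ 2.
    by field; rewrite gt_eqF.
  by rewrite subr_ge0.
move=> c_le0; have c00 : c = 0 by apply/eqP; rewrite eq_le c_le0.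
subst c; rewrite mulr0.
have [->|b0] := eqVneq b 0; first by rewrite expr0n.
have := abc (- (a + 1) / (2 * b)).
have -> : a + 2 * (- (a + 1) / (2 * b)) * b + (- (a + 1) / (2 * b)) ^+ 2 * 0
  = -1 by field.
by rewrite ler0N1.
Qed.

Section L2.
Context {d} {T : measurableType d} {R : realType} (mu : probability T R).
Implicit Types (f g h : T -> R) (K : set (T -> R)).

Definition L2 : set (T -> R) := [set f | f \in Lfun mu 2%:E].

Definition ip f g : R := \int[mu]_x (f x * g x).

(** Squared distances are at most of order [4^-n], that is distances of order
    [2^-n]: such sequences converge almost everywhere without extracting a
    subsequence, and minimizing sequences can be chosen so. *)
Definition fast_cauchy (s : nat -> T -> R) := exists C : R,
  forall n m, (n <= m)%N -> ip (s m - s n) (s m - s n) <= C * (4^-1) ^+ n.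

Definition fast_cvg (s : nat -> T -> R) f := exists C : R,
  forall n, ip (f - s n) (f - s n) <= C * (4^-1) ^+ n.

Definition L2_complete K := forall s, (forall n, K (s n)) -> fast_cauchy s ->
  exists2 f, K f & fast_cvg s f.

Lemma L2_measurable f : L2 f -> measurable_fun setT f.
Proof. by rewrite /L2/= inE => /andP[/[!inE]]. Qed.

Lemma L2P f : L2 f <->
  measurable_fun setT f /\ (\int[mu]_x (f x ^+ 2)%:E < +oo)%E.
Proof.
split=> [L2f|[mf foo]].
  split; first exact: L2_measurable.
  have /integrableP[_] := Lfun2_integrable_sqr L2f.
  by under eq_integral do rewrite /= ger0_norm ?sqr_ge0//.
rewrite /L2/= inE; apply/andP; split; rewrite inE//=.
rewrite /finite_norm unlock poweR_lty//.
by under eq_integral do rewrite /= powR_mulrn// real_normK ?num_real//.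
Qed.

Lemma L2D f g : L2 f -> L2 g -> L2 (f + g).
Proof.
by have [_ +] := Lfun_addr_closed mu (lee1n 2 : (1 <= 2%:E)%E); apply.
Qed.

Lemma L2Z a f : L2 f -> L2 (a *: f).
Proof.
move=> L2f; rewrite (_ : a *: f = a \o* f); last first.
  by apply/funext => x /=; exact: mulrC.
exact: (@Lfun_scale _ _ _ mu f a 2 (ler1n _ 2)).
Qed.

Lemma L20 : L2 0.
Proof. by have [+ _] := Lfun_addr_closed mu (lee1n 2 : (1 <= 2%:E)%E). Qed.

Lemma L2B f g : L2 f -> L2 g -> L2 (f - g).
Proof. by move=> L2f L2g; rewrite -scaleN1r; apply/L2D/L2Z. Qed.

Lemma L2_sum (I : finType) (F : pred I) (e : I -> T -> R) :
  (forall i, F i -> L2 (e i)) -> L2 (\sum_(i | F i) e i).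
Proof. by move=> L2e; elim/big_ind : _ => //; [exact: L20|exact: L2D]. Qed.

Lemma L2_integrableM f g : L2 f -> L2 g ->
  mu.-integrable setT (fun x => (f x * g x)%:E).
Proof. by move=> L2f L2g; apply/Lfun1_integrable/Lfun2_mul_Lfun1. Qed.

Lemma L2_integrable f : L2 f -> mu.-integrable setT (EFin \o f).
Proof.
move=> L2f; apply/Lfun1_integrable; move: L2f; apply: Lfun_subset12.
by rewrite fin_num_measure.
Qed.

Lemma ipE f g : L2 f -> L2 g -> (ip f g)%:E = (\int[mu]_x (f x * g x)%:E)%E.
Proof.
by move=> L2f L2g; rewrite fineK// integrable_fin_num//; exact: L2_integrableM.
Qed.

Lemma ipxxE f : L2 f -> (ip f f)%:E = (\int[mu]_x (f x ^+ 2)%:E)%E.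
Proof. by move=> L2f; rewrite ipE//; under eq_integral do rewrite -expr2. Qed.

Lemma ipC f g : ip f g = ip g f.
Proof. by apply: eq_Rintegral => x _; rewrite mulrC. Qed.

Lemma ipDl f g h : L2 f -> L2 g -> L2 h -> ip (f + g) h = ip f h + ip g h.
Proof.
move=> *; rewrite -RintegralD//; [|exact: L2_integrableM..].
by apply: eq_Rintegral => x _; exact: mulrDl.
Qed.

Lemma ipZl a f h : L2 f -> L2 h -> ip (a *: f) h = a * ip f h.
Proof.
move=> *; rewrite -RintegralZl//; [|exact: L2_integrableM].
by apply: eq_Rintegral => x _; rewrite mulrA.
Qed.

Lemma ipBl f g h : L2 f -> L2 g -> L2 h -> ip (f - g) h = ip f h - ip g h.
Proof.
move=> *; rewrite -scaleN1r ipDl ?ipZl ?mulN1r//; exact: L2Z.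
Qed.

Lemma ipDr f g h : L2 f -> L2 g -> L2 h -> ip h (f + g) = ip h f + ip h g.
Proof. by move=> *; rewrite ipC ipDl// ![ip _ h]ipC. Qed.

Lemma ipZr a f h : L2 f -> L2 h -> ip h (a *: f) = a * ip h f.
Proof. by move=> *; rewrite ipC ipZl// [ip _ h]ipC. Qed.

Lemma ipBr f g h : L2 f -> L2 g -> L2 h -> ip h (f - g) = ip h f - ip h g.
Proof. by move=> *; rewrite ipC ipBl// ![ip _ h]ipC. Qed.

Lemma ip0l h : ip 0 h = 0.
Proof.
by rewrite -[RHS](Rintegral_set0 mu h) /ip /Rintegral integral_set0 integral0_eq//
  => x _; rewrite mul0r.
Qed.

Lemma ip_suml (I : finType) (F : pred I) (e : I -> T -> R) h :
  (forall i, F i -> L2 (e i)) -> L2 h ->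
  ip (\sum_(i | F i) e i) h = \sum_(i | F i) ip (e i) h.
Proof.
move=> L2e L2h.
suff [] : L2 (\sum_(i | F i) e i) /\
    ip (\sum_(i | F i) e i) h = \sum_(i | F i) ip (e i) h by [].
elim/big_rec2 : _ => [|i x f Fi [L2f fx]].
  by rewrite ip0l; split=> //; exact: L20.
by rewrite ipDl ?fx//; [split=> //; apply/L2D/L2f; exact: L2e|exact: L2e].
Qed.

Lemma ip_ge0 f : 0 <= ip f f.
Proof. by apply: Rintegral_ge0 => x _; rewrite -expr2 sqr_ge0. Qed.

Lemma ipDD f g : L2 f -> L2 g ->
  ip (f + g) (f + g) = ip f f + 2 * ip f g + ip g g.
Proof.
move=> L2f L2g; have L2fg := L2D L2f L2g.
by rewrite ipDl// !ipDr// [ip g f]ipC; ring.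
Qed.

Lemma ipBB f g : L2 f -> L2 g ->
  ip (f - g) (f - g) = ip f f - 2 * ip f g + ip g g.
Proof.
move=> L2f L2g; have L2fg := L2B L2f L2g.
by rewrite ipBl// !ipBr// [ip g f]ipC; ring.
Qed.

Lemma ip_sqrD_le f g : L2 f -> L2 g ->
  ip (f + g) (f + g) <= 2 * ip f f + 2 * ip g g.
Proof.
move=> L2f L2g; have := ip_ge0 (f - g); rewrite ipBB// ipDD//; lra.
Qed.

Lemma ip_sqrB_le f g : L2 f -> L2 g ->
  ip (f - g) (f - g) <= 2 * ip f f + 2 * ip g g.
Proof.
move=> L2f L2g; have := ip_ge0 (f + g); rewrite ipBB// ipDD//; lra.
Qed.

Lemma ip_sqr_le f g : L2 f -> L2 g -> (ip f g) ^+ 2 <= ip f f * ip g g.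
Proof.
move=> L2f L2g; apply: discriminant_le => [||t]; [exact: ip_ge0..|].
have L2tg := L2Z t L2g.
by have := ip_ge0 (f + t *: g); rewrite ipDD// !(ipZr, ipZl)//; lra.
Qed.

Lemma ip_eq0 f : L2 f -> ip f f = 0 -> f = cst 0 %[ae mu].
Proof.
move=> L2f f0; have := ipxxE L2f; rewrite f0 => /esym i0.
have mf : measurable_fun setT (fun x => (f x ^+ 2)%:E : \bar R).
  by apply/measurable_EFinP; apply: measurable_funX; exact: L2_measurable.
have : (\int[mu]_x `|(f x ^+ 2)%:E| = 0)%E.
  by rewrite -[RHS]i0; apply: eq_integral => x _; rewrite gee0_abs// lee_fin sqr_ge0.
move/(ae_eq_integral_abs mu measurableT mf).
apply: filterS => x /(_ I)[] /eqP; rewrite sqrf_eq0 => /eqP -> //.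
Qed.

Lemma ip_ae f f' g : L2 f -> L2 f' -> L2 g -> f = f' %[ae mu] -> ip f g = ip f' g.
Proof.
move=> L2f L2f' L2g ff'; apply: EFin_inj; rewrite !ipE//.
apply: ae_eq_integral => //.
- by have /measurable_int := L2_integrableM L2f L2g.
- by have /measurable_int := L2_integrableM L2f' L2g.
by apply: filterS ff' => x /(_ I) ff' _; rewrite ff'.
Qed.

Lemma fast_cvg_ip s f g : (forall n, L2 (s n)) -> L2 f -> L2 g ->
  fast_cvg s f -> (forall n, ip (s n) g = 0) -> ip f g = 0.
Proof.
move=> L2s L2f L2g [C fC] f0; apply/eqP; rewrite -sqrf_eq0 eq_le sqr_ge0 andbT.
apply: (@le0_of_le_geometric _ _ (C * ip g g)) => n.
have -> : ip f g = ip (f - s n) g by rewrite ipBl// f0 subr0.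
apply: le_trans (ip_sqr_le (L2B L2f (L2s n)) L2g) _.
by rewrite mulrAC ler_wpM2r ?ip_ge0.
Qed.

End L2.

(** * Completeness *)

Section completeness.
Context {R : realType}.

(** The increments are summable because [|D| <= 2^k * D^2 + 2^-k]. *)
Lemma cvg_sum_sqr_telescope (u : R^nat) (B : R) :
  (forall n, \sum_(0 <= k < n) 2 ^+ k * (u k.+1 - u k) ^+ 2 <= B) -> cvgn u.
Proof.
move=> uB.
have leD k : `|u k.+1 - u k| <= 2 ^+ k * (u k.+1 - u k) ^+ 2 + (2^-1) ^+ k.
  set D := _ - _; set r := 2 ^+ k; have r0 : 0 < r by rewrite exprn_gt0.
  rewrite exprVn -(ler_pM2l r0) -/r mulrDr mulfV ?gt_eqF//.
  rewrite -(real_normK (num_real D)); set a := `|D|.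
  by have := sqr_ge0 (r * a - 2^-1); nra.
have geo n : \sum_(0 <= k < n) (2^-1 : R) ^+ k <= 2.
  suff -> : \sum_(0 <= k < n) (2^-1 : R) ^+ k = 2 - 2 * (2^-1) ^+ n.
    by rewrite lerBlDr lerDl mulr_ge0// exprn_ge0.
  elim: n => [|n IH]; first by rewrite big_nil expr0; ring.
  by rewrite big_nat_recr//= IH exprS; field.
have ctel : cvgn (series (telescope u)).
  apply: normed_cvg; apply: nondecreasing_is_cvgn.
    apply/nondecreasing_seqP => n; rewrite /=. rewrite seriesSr.
    by rewrite lerDl.
  exists (B + 2) => _ [n _ <-]; rewrite /series/=.
  apply: le_trans (lerD (uB n) (geo n)); rewrite -big_split/=.
  by apply: ler_sum => k _; exact: leD.
rewrite (_ : u = (fun n => u 0%N + series (telescope u) n)).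
  by apply: is_cvgD => //; exact: is_cvg_cst.
by apply/funext => n; rewrite -eq_sum_telescope.
Qed.

Lemma limn_einf_le (u : (\bar R)^nat) (M : \bar R) :
  (forall n, (u n <= M)%E) -> (limn_einf u <= M)%E.
Proof.
move=> uM; rewrite limn_einf_lim; apply: lime_le; first exact: is_cvg_einfs.
apply: nearW => n; apply: le_trans (uM n); apply: ereal_inf_lbound.
by exists n => /=.
Qed.

Lemma limn_einf_ge0 (u : (\bar R)^nat) :
  (forall n, (0 <= u n)%E) -> (0 <= limn_einf u)%E.
Proof.
move=> u0; rewrite limn_einf_lim; apply: lime_ge; first exact: is_cvg_einfs.
by apply: nearW => n; apply: le_ereal_inf_tmp => _ [m _ <-].
Qed.

Lemma measurable_fun_limn_einf {d} {T : measurableType d}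
    (f : (T -> \bar R)^nat) : (forall n, measurable_fun setT (f n)) ->
  measurable_fun setT (fun x => limn_einf (f ^~ x)).
Proof.
move=> mf; rewrite (_ : (fun _ => _) =
    (fun x => - limn_esup (fun n => - f n x))%E); last first.
  by apply/funext => x; rewrite limn_esupN oppeK.
apply: measurableT_comp => //; apply: measurable_fun_limn_esup => n.
exact: measurableT_comp.
Qed.

Context {d} {T : measurableType d} (mu : probability T R).
Local Notation L2 := (L2 mu).
Local Notation ip := (ip mu).

(** The series of the [2^k * (s k.+1 - s k)^2] has a finite integral, so that it
    is finite almost everywhere. *)
Lemma fast_cauchy_ae_cvg (s : nat -> T -> R) : (forall n, L2 (s n)) ->
  fast_cauchy mu s -> \forall x \ae mu, cvgn (s ^~ x).
Proof.
move=> L2s [C sC].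
pose D k x : \bar R := (2 ^+ k * (s k.+1 x - s k x) ^+ 2)%:E.
have D0 k x : setT x -> (0 <= D k x)%E.
  by move=> _; rewrite lee_fin; apply: mulr_ge0; [exact: exprn_ge0|exact: sqr_ge0].
have mD k : measurable_fun setT (D k).
  apply/measurable_EFinP; apply: measurable_funM => //.
  by apply: measurable_funX; apply: measurable_funB; exact: L2_measurable.
(* The weight [2^k] loses only half of the geometric rate. *)
have iD k : (\int[mu]_x D k x <= (C * 2^-1 ^+ k)%:E)%E.
  rewrite /D; under eq_integral do rewrite EFinM.
  have L2B1 := L2B (L2s k.+1) (L2s k).
  rewrite ge0_integralZl//.
  - rewrite -ipxxE// -EFinM lee_fin.
    apply: le_trans (_ : 2 ^+ k * (C * 4^-1 ^+ k) <= _); last first.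
      rewrite mulrCA -exprMn_comm; last by rewrite /GRing.comm mulrC.
      by rewrite (_ : 2 * 4^-1 = 2^-1 :> R)//; lra.
    by rewrite ler_wpM2l ?exprn_ge0// sC.
  - by apply/measurable_EFinP; apply: measurable_funX; exact: L2_measurable L2B1.
  - by move=> x _; rewrite lee_fin sqr_ge0.
have iDoo : (\int[mu]_x (\sum_(n <oo) D n x) < +oo)%E.
  rewrite integral_nneseries//.
  apply: le_lt_trans (_ : (\sum_(n <oo) (C * 2^-1 ^+ n)%:E) < _)%E.
    apply: lee_nneseries => [n _ _|n _]; last exact: iD.
    by apply: integral_ge0 => x; exact: D0.
  have := @cvg_geometric_eseries_half R (2 * C) 0; rewrite expr0 divr1.
  move/cvg_lim => /=; rewrite /eseries/=.
  under [X in limn X]eq_fun do under eq_bigr do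
    rewrite addn1 natrX exprS invfM mulrACA mulfV// mul1r -exprVn.
  by move=> ->//; rewrite ltry.
have mSD : measurable_fun setT (fun x => \sum_(n <oo) D n x)%E.
  by apply: ge0_emeasurable_sum => // k x _ _; exact: D0.
have SD0 x : (0 <= \sum_(n <oo) D n x)%E.
  by apply: nneseries_ge0 => n _ _; exact: D0.
have /(integrable_ae measurableT) :
    mu.-integrable setT (fun x => \sum_(n <oo) D n x)%E.
  apply/integrableP; split => //.
  by under eq_integral do rewrite gee0_abs//.
apply: filterS => x /(_ I) SDfin.
apply: (@cvg_sum_sqr_telescope _ (fine (\sum_(n <oo) D n x)%E)) => n.
rewrite -lee_fin fineK// -sumEFin; apply: nneseries_lim_ge => k _ _; exact: D0.
Qed.

(** The limit is taken pointwise, so that it does not separate points that the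
    sequence does not separate; thus a limit of functions of a subvector is, at
    every point, a function of this subvector.  Fatou gives the rate. *)
Lemma L2_limit (s : nat -> T -> R) : (forall n, L2 (s n)) ->
  fast_cauchy mu s -> exists f, [/\ L2 f, fast_cvg mu s f &
  forall x y, (forall n, s n x = s n y) -> f x = f y].
Proof.
move=> L2s cs; have cvs := fast_cauchy_ae_cvg L2s cs.
(* The upper limit is defined, and measurable, also where [s] diverges. *)
pose f x := fine (limn_esup (fun n => (s n x)%:E)).
have ms n : measurable_fun setT (s n) by exact: L2_measurable.
have mf : measurable_fun setT f.
  apply: measurableT_comp => //.
  by apply: measurable_fun_limn_esup => n; exact/measurable_EFinP.
have [C sC] := cs.
have fsC n : (\int[mu]_x ((f x - s n x) ^+ 2)%:E <= (C * 4^-1 ^+ n)%:E)%E.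
  pose g m x := ((s (n + m)%N x - s n x) ^+ 2)%:E.
  have mg m : measurable_fun setT (g m).
    by apply/measurable_EFinP; apply: measurable_funX; exact: measurable_funB.
  have g0 m x : setT x -> (0 <= g m x)%E by move=> _; rewrite lee_fin sqr_ge0.
  apply: (@le_trans _ _ (\int[mu]_x limn_einf (g ^~ x))%E).
    apply: ae_ge0_le_integral => //.
    - by move=> x _; rewrite lee_fin sqr_ge0.
    - by apply/measurable_EFinP; apply: measurable_funX; exact: measurable_funB.
    - by move=> x _; apply: limn_einf_ge0 => m; exact: g0.
    - exact: measurable_fun_limn_einf.
    apply: filterS cvs => x cx _.
    have sEx : (s m x)%:E @[m --> \oo] --> (limn (s ^~ x))%:E.
      exact: cvg_EFin (nearW _ _) cx.
    have fx : f x = limn (s ^~ x) by rewrite /f (cvg_limn_einf_sup sEx).2.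
    have gx : g m x @[m --> \oo] --> ((f x - s n x) ^+ 2)%:E.
      apply: cvg_EFin; first exact: nearW.
      have snx : s (n + m)%N x @[m --> \oo] --> limn (s ^~ x).
        exact: (cvg_comp _ (s ^~ x) (cvg_addnl n) cx).
      have dnx : s (n + m)%N x - s n x @[m --> \oo] --> limn (s ^~ x) - s n x.
        by apply: cvgB => //; exact: cvg_cst.
      by rewrite fx expr2; exact: (cvgM dnx dnx).
    by rewrite (cvg_limn_einf_sup gx).1.
  apply: le_trans (fatou mu measurableT mg g0) _.
  apply: limn_einf_le => m; have L2D1 := L2B (L2s (n + m)%N) (L2s n).
  by rewrite -ipxxE// lee_fin sC// leq_addr.
have L2f : L2 f.
  rewrite -[f](subrK (s 0%N)); apply: L2D => //; apply/L2P; split.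
    exact: measurable_funB.
  exact: le_lt_trans (fsC 0%N) (ltry _).
exists f; split => //.
  exists C => n; rewrite -lee_fin ipxxE; [exact: fsC|exact: L2B].
move=> x y sxy; rewrite /f; congr (fine (limn_esup _)).
by apply/funext => n; rewrite sxy.
Qed.

End completeness.

(** * Orthogonal projection on complete subspaces *)

Section projection.
Context {d} {T : measurableType d} {R : realType} (mu : probability T R).
Local Notation L2 := (L2 mu).
Local Notation ip := (ip mu).
Local Notation fast_cvg := (fast_cvg mu).
Local Notation L2_complete := (L2_complete mu).
Implicit Types (f g h : T -> R) (K : set (T -> R)).

Definition L2_subspace K :=
  [/\ K `<=` L2, K 0 & forall (a : R) f g, K f -> K g -> K (a *: f + g)].

Lemma subspaceD K f g : L2_subspace K -> K f -> K g -> K (f + g).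
Proof. by move=> [_ _ KD] Kf Kg; rewrite -[f]scale1r; exact: KD. Qed.

Lemma subspaceZ K (a : R) f : L2_subspace K -> K f -> K (a *: f).
Proof. by move=> [_ K0 KD] Kf; rewrite -[_ *: _]addr0; exact: KD. Qed.

Lemma subspaceB K f g : L2_subspace K -> K f -> K g -> K (f - g).
Proof.
move=> sK Kf Kg; rewrite -scaleN1r; apply: subspaceD => //; exact: subspaceZ.
Qed.

Lemma subspace_sum K (I : finType) (F : pred I) (e : I -> T -> R) :
  L2_subspace K -> (forall i, F i -> K (e i)) -> K (\sum_(i | F i) e i).
Proof.
move=> sK Ke; elim/big_ind : _ => //; first by case: sK.
by move=> f g; exact: subspaceD.
Qed.

Lemma fast_cvgD (s t : nat -> T -> R) f g :
  (forall n, L2 (s n)) -> (forall n, L2 (t n)) -> L2 f -> L2 g ->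
  fast_cvg s f -> fast_cvg t g -> fast_cvg (fun n => s n + t n) (f + g).
Proof.
move=> L2s L2t L2f L2g [C sC] [D tD]; exists (2 * C + 2 * D) => n.
rewrite opprD addrACA.
apply: le_trans (ip_sqrD_le (L2B L2f (L2s n)) (L2B L2g (L2t n))) _.
by have := sC n; have := tD n; lra.
Qed.

Lemma fast_cvg_sum (I : finType) (F : pred I) (s : nat -> I -> T -> R)
    (f : I -> T -> R) :
  (forall n i, F i -> L2 (s n i)) -> (forall i, F i -> L2 (f i)) ->
  (forall i, F i -> fast_cvg (fun n => s n i) (f i)) ->
  fast_cvg (fun n => \sum_(i | F i) s n i) (\sum_(i | F i) f i).
Proof.
move=> L2s L2f sf.
have sum1E (u : I -> T -> R) i (r : seq I) :
    \sum_(j <- i :: r | F j) u j =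
    (if F i then u i else 0) + \sum_(j <- r | F j) u j.
  by rewrite big_cons; case: ifP; rewrite ?add0r.
have L2sum (u : I -> T -> R) (r : seq I) : (forall i, F i -> L2 (u i)) ->
  L2 (\sum_(j <- r | F j) u j).
  by move=> L2u; elim/big_ind : _ => //; [exact: L20|exact: L2D].
rewrite /index_enum; elim: (Finite.enum _) => [|i r IH].
  exists 0 => n; rewrite !big_nil subrr mul0r.
  by rewrite ip0l.
rewrite sum1E; under eq_fun do rewrite sum1E.
apply: fast_cvgD => //;
  [|by move=> n; apply: L2sum => j; exact: L2s| |exact: L2sum|].
- by move=> n; case: ifPn => Fi; [exact: L2s|exact: L20].
- by case: ifPn => Fi; [exact: L2f|exact: L20].
- case: ifPn => Fi; first exact: sf.
  by exists 0 => n; rewrite subrr ip0l mul0r.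
Qed.

(** The classical argument: by the parallelogram identity a minimizing sequence of
    the distance to [h] is Cauchy, and its limit is the projection. *)
Lemma complete_projection K h : L2_subspace K -> L2_complete K -> L2 h ->
  exists2 k, K k & forall g, K g -> ip (h - k) g = 0.
Proof.
move=> sK cK L2h; have [KL2 K0 _] := sK.
pose E : set R := [set ip (h - k) (h - k) | k in K].
have E0 : E !=set0 by exists (ip (h - 0) (h - 0)), 0.
have lbE : has_lbound E by exists 0 => _ [k _ <-]; exact: ip_ge0.
pose D := inf E.
have DK k : K k -> D <= ip (h - k) (h - k).
  by move=> Kk; apply: ge_inf => //; exists k.
have /choice[s sP] n : exists k, K k /\ ip (h - k) (h - k) <= D + 4^-1 ^+ n.
  have e0 : 0 < (4^-1 : R) ^+ n by rewrite exprn_gt0 ?invr_gt0.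
  have [_ [k Kk <-] kD] := inf_adherent e0 (conj E0 lbE).
  by exists k; split => //; exact: ltW.
have Ks n : K (s n) by have [] := sP n.
have L2s n : L2 (s n) by exact: KL2.
have [k Kk [C sk]] : exists2 k, K k & fast_cvg s k.
  apply: cK => //; exists 4 => n m nm.
  have L2n := L2B L2h (L2s n); have L2m := L2B L2h (L2s m).
  have -> : s m - s n = (h - s n) - (h - s m).
    by apply/funext => x; rewrite !fctE; ring.
  have Kmid : K (2^-1 *: (s n + s m)).
    by apply: subspaceZ => //; exact: subspaceD.
  have : D * 4 <= ip ((h - s n) + (h - s m)) ((h - s n) + (h - s m)).
    have -> : (h - s n) + (h - s m) = 2 *: (h - 2^-1 *: (s n + s m)).
      by apply/funext => x; rewrite !fctE /GRing.scale/=; field.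
    have L2mid := L2B L2h (KL2 _ Kmid).
    rewrite ipZl ?ipZr//; last exact: L2Z.
    by have := DK _ Kmid; lra.
  have mn : (4^-1 : R) ^+ m <= 4^-1 ^+ n.
    by apply: ler_wiXn2l => //; rewrite ?invr_ge0// invf_le1// ler1n.
  have [_ sn] := sP n; have [_ sm] := sP m.
  rewrite (ipDD L2n L2m) (ipBB L2n L2m); lra.
exists k => // g Kg.
have L2k := KL2 _ Kk; have L2g := KL2 _ Kg.
have L2hk := L2B L2h L2k.
(* The near-minimality of [s n] bounds its defect of orthogonality to [g]. *)
apply/eqP; rewrite -sqrf_eq0 eq_le sqr_ge0 andbT.
apply: (@le0_of_le_geometric _ _ (2 * (1 + C) * ip g g)) => n.
have L2hs := L2B L2h (L2s n); have L2sk := L2B L2k (L2s n).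
have hs_le : ip (h - s n) g ^+ 2 <= 4^-1 ^+ n * ip g g.
  apply: discriminant_le => [||t]; [by rewrite exprn_ge0 ?invr_ge0|exact: ip_ge0|].
  have := DK _ (subspaceB sK (Ks n) (subspaceZ t sK Kg)).
  have -> : h - (s n - t *: g) = (h - s n) + t *: g.
    by apply/funext => x; rewrite !fctE; ring.
  have L2tg := L2Z t L2g; have [_ sn] := sP n.
  by rewrite ipDD// !(ipZr, ipZl)//; lra.
have sk_le : ip (k - s n) g ^+ 2 <= C * 4^-1 ^+ n * ip g g.
  by apply: le_trans (ip_sqr_le L2sk L2g) _; rewrite ler_wpM2r ?ip_ge0.
have -> : h - k = (h - s n) - (k - s n).
  by apply/funext => x; rewrite !fctE; ring.
rewrite ipBl//; have := sqr_ge0 (ip (h - s n) g + ip (k - s n) g); lra.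
Qed.

Lemma subspace_sums (I : finType) (F : pred I) (A : I -> set (T -> R)) :
  (forall i, F i -> L2_subspace (A i)) ->
  L2_subspace [set f | exists2 e, (forall i, F i -> A i (e i)) &
    f = \sum_(i | F i) e i].
Proof.
move=> sA; split.
- move=> _ [e Ae ->]; apply: L2_sum => i Fi; have [AL2 _ _] := sA i Fi.
  exact/AL2/Ae.
- exists (fun=> 0); last by rewrite big1.
  by move=> i Fi; have [] := sA i Fi.
- move=> a _ _ [e Ae ->] [e' Ae' ->]; exists (fun i => a *: e i + e' i).
    by move=> i Fi; have [_ _] := sA i Fi; apply; [exact: Ae|exact: Ae'].
  by rewrite big_split scaler_sumr.
Qed.

(** The lower bound turns a Cauchy sequence of sums into Cauchy sequences of
    members. *)
Lemma complete_sums (I : finType) (F : pred I) (A : I -> set (T -> R)) (c : R) :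
  0 < c -> (forall i, F i -> L2_subspace (A i)) ->
  (forall i, F i -> L2_complete (A i)) ->
  (forall e, (forall i, F i -> A i (e i)) ->
    c * \sum_(i | F i) ip (e i) (e i) <=
      ip (\sum_(i | F i) e i) (\sum_(i | F i) e i)) ->
  L2_complete [set f | exists2 e, (forall i, F i -> A i (e i)) &
    f = \sum_(i | F i) e i].
Proof.
move=> c0 sA cA ce s Ks [C sC].
have /choice[e eP] n : exists e, (forall i, F i -> A i (e i)) /\
    s n = \sum_(i | F i) e i.
  by have [e Ae se] := Ks n; exists e.
have Ae n i : F i -> A i (e n i) by have [+ _] := eP n; apply.
have AL2 i f : F i -> A i f -> L2 f by move=> Fi; have [+ _ _] := sA i Fi; apply.
have ce_cauchy i : F i -> fast_cauchy mu (fun n => e n i).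
  move=> Fi; exists (C / c) => n m nm.
  have /ce : forall j, F j -> A j (e m j - e n j).
    by move=> j Fj; apply: subspaceB; [exact: sA|exact: Ae..].
  rewrite sumrB -!(eP _).2 => /le_trans /(_ (sC n m nm)).
  rewrite mulrAC ler_pdivlMr// [leLHS]mulrC => ceC.
  apply: le_trans ceC; rewrite ler_pM2r//.
  by rewrite (bigD1 i)//= lerDl sumr_ge0// => j _; exact: ip_ge0.
have /choice[f fP] i : exists f, F i -> A i f /\ fast_cvg (fun n => e n i) f.
  have [Fi|nFi] := boolP (F i); last by exists 0.
  by have [f Af ef] := cA i Fi _ (fun n => Ae n i Fi) (ce_cauchy i Fi); exists f.
exists (\sum_(i | F i) f i).
  by exists f => // i Fi; have [] := fP i Fi.
rewrite (_ : s = fun n => \sum_(i | F i) e n i); last first.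
  by apply/funext => n; have [] := eP n.
apply: fast_cvg_sum.
- by move=> n i Fi; apply: (AL2 i) => //; exact: Ae.
- by move=> i Fi; apply: (AL2 i) => //; have [] := fP i Fi.
- by move=> i Fi; have [] := fP i Fi.
Qed.

End projection.

(** * Gluing subvectors *)

Section merge.
Context {R : realType} {p : nat}.
Implicit Types (u v : {set 'I_p}) (x y : p.-tuple R).

(** The coordinates outside [u] are [0]: for them the index is the size of [a], and
    [nth] returns its default value. *)
Definition pad u (a : #|u|.-tuple R) : p.-tuple R :=
  [tuple nth 0 a (index i (enum u)) | i < p].

Definition merge u x y : p.-tuple R :=
  [tuple if i \in u then tnth x i else tnth y i | i < p].

Definition glue u (ab : #|u|.-tuple R * #|~: u|.-tuple R) : p.-tuple R :=
  merge u (pad ab.1) (pad ab.2).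

Lemma tnth_pad u (a : #|u|.-tuple R) k : tnth (pad a) (enum_val k) = tnth a k.
Proof.
rewrite tnth_mktuple (tnth_nth 0) /enum_val index_uniq ?enum_uniq//.
by rewrite -cardE.
Qed.

Lemma tnth_pad_subvect u x i : i \in u -> tnth (pad (subvect u x)) i = tnth x i.
Proof.
move=> iu; rewrite -[i](enum_rankK_in iu iu) tnth_pad tnth_mktuple.
by rewrite enum_rankK_in.
Qed.

Lemma subvect_eq u x y : (forall i, i \in u -> tnth x i = tnth y i) ->
  subvect u x = subvect u y.
Proof.
by move=> xy; apply: eq_from_tnth => k; rewrite !tnth_mktuple xy// enum_valP.
Qed.

Lemma tnth_subvect u x k : tnth (subvect u x) k = tnth x (enum_val k).
Proof. exact: tnth_mktuple. Qed.

Lemma subvect_glue u ab : subvect u (glue ab) = ab.1.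
Proof.
apply: eq_from_tnth => k; rewrite !tnth_mktuple enum_valP.
by rewrite -[LHS](tnth_mktuple (fun i => nth 0 ab.1 (index i (enum u)))) tnth_pad.
Qed.

Lemma subvectC_glue u ab : subvect (~: u) (glue ab) = ab.2.
Proof.
apply: eq_from_tnth => k; rewrite !tnth_mktuple.
have /[!inE]/negPf -> := enum_valP k.
by rewrite -[LHS](tnth_mktuple (fun i => nth 0 ab.2 (index i (enum (~: u))))) tnth_pad.
Qed.

Lemma glue_subvect u x y : glue (subvect u x, subvect (~: u) y) = merge u x y.
Proof.
apply: eq_from_tnth => i; rewrite !(tnth_mktuple (fun i => if _ then _ else _)).
case: ifPn => iu; rewrite tnth_pad_subvect// finset.in_setC; exact: iu.
Qed.

Lemma measurable_pad u : measurable_fun setT (@pad u).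
Proof.
apply/measurable_fun_tnthP => i.
have [iu|iu] := boolP (i \in u).
  rewrite (_ : _ \o _ = (@tnth _ R)^~ (enum_rank_in iu i)).
    exact: measurable_tnth.
  by apply/funext => a /=; rewrite -{1}[i](enum_rankK_in iu iu) tnth_pad.
rewrite (_ : _ \o _ = cst 0); first exact: measurable_cst.
apply/funext => a /=; rewrite tnth_mktuple nth_default//.
by rewrite size_tuple cardE leqNgt index_mem mem_enum.
Qed.

Lemma measurable_merge d (T : measurableType d) u (f g : T -> p.-tuple R) :
  measurable_fun setT f -> measurable_fun setT g ->
  measurable_fun setT (fun t => merge u (f t) (g t)).
Proof.
move=> mf mg; apply/measurable_fun_tnthP => i.
rewrite (_ : _ \o _ =
    if i \in u then (@tnth _ R)^~ i \o f else (@tnth _ R)^~ i \o g).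
  by case: ifP => _; apply: measurableT_comp => //; exact: measurable_tnth.
by apply/funext => t /=; rewrite tnth_mktuple; case: ifP.
Qed.

Lemma measurable_glue u : measurable_fun setT (@glue u).
Proof.
by apply: measurable_merge; apply: measurableT_comp => //; exact: measurable_pad.
Qed.

HB.instance Definition _ u :=
  isMeasurableFun.Build _ _ _ _ (@glue u) (@measurable_glue u).

End merge.

(** * Product measures *)

Section product_measure.
Context {R : realType}.
Local Open Scope ereal_scope.

Definition box n (A : 'I_n -> set R) : set (n.-tuple R) :=
  [set x | forall i, A i (tnth x i)].

Lemma measurable_box n (A : 'I_n -> set R) :
  (forall i, measurable (A i)) -> measurable (box A).
Proof.
move=> mA; rewrite (_ : box A = \bigcap_i ((tnth (T:=R))^~ i @^-1` A i)).
  apply: fin_bigcap_measurable => [|i _]; first exact: finite_finset.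
  by rewrite -[_ @^-1` _]setTI; exact: measurable_tnth.
by apply/seteqP; split => x /= Ax i; [move=> _; exact: Ax|exact: Ax].
Qed.

Lemma measurable_boxE n : @measurable _ (n.-tuple R) =
  <<s [set B | exists2 A : 'I_n -> set R, (forall i, measurable (A i)) &
        B = box A] >>.
Proof.
apply/seteqP; split; last first.
  apply: smallest_sub; first exact: sigma_algebra_measurable.
  by move=> _ [A mA ->]; exact: measurable_box.
apply: sub_smallest2r; first exact: smallest_sigma_algebra.
apply: (big_ind (fun S => S `<=` _)) => [//|S S' SC S'C B [/SC|/S'C]//|i _].
move=> _ [A mA <-]; rewrite setTI.
exists (fun j => if j == i then A else setT); first by move=> j; case: ifP.
apply/seteqP; split => [x Ax j|x /(_ i)]; last by rewrite eqxx.
by case: eqP => // ->.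
Qed.

(** Boxes form a generating pi-system, and products of sets of finite measure
    exhaust the space. *)
Lemma prod_measure_unique n (nu : 'I_n -> {sigma_finite_measure set R -> \bar R})
    (m : {measure set (n.-tuple R) -> \bar R}) :
  (forall A : 'I_n -> set R, (forall i, measurable (A i)) ->
    m (box A) = \prod_(i < n) nu i (A i)) ->
  forall B, measurable B -> prod_measure nu B = m B.
Proof.
move=> mE B mB.
have /choice[F FP] i := (sigma_finiteP _ _).1 (sigma_finiteT (nu i)).
apply: (measure_unique [set B | exists2 A : 'I_n -> set R,
    (forall i, measurable (A i)) & B = box A] (fun k => box (F^~ k))) => //.
- exact: measurable_boxE.
- move=> _ _ [A mA ->] [A' mA' ->]; exists (fun i => A i `&` A' i).
    by move=> i; exact: measurableI.
  apply/seteqP; split => [x [Ax A'x] i|x AA']; first by split; [exact: Ax|exact: A'x].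
  by split => i; have [] := AA' i.
- move=> k; exists (F^~ k) => // i; have [_ _ Foo] := FP i.
  by have [] := Foo k.
- rewrite -subTset => x _.
  have /choice[k xk] i : exists k, F i k (tnth x i).
    have [FT _ _] := FP i.
    have [k _ Fk] : (\bigcup_k F i k) (tnth x i) by rewrite -FT.
    by exists k.
  (* The covers are nondecreasing: one index serves all the coordinates. *)
  exists (\max_i k i)%N => // i; have [_ ndF _] := FP i.
  by move: (xk i); apply/subsetPset/ndF/leq_bigmax.
- by move=> _ [A mA ->]; rewrite mE//; exact: prod_measure_box.
- move=> k; rewrite [ltLHS]prod_measure_box; last first.
    by move=> i; have [_ _ /(_ k)[]] := FP i.
  suff /andP[] : 0 <= \prod_(i < n) nu i (F i k) < +oo by [].
  elim/big_ind : _ => [|x y /andP[x0 xoo] /andP[y0 yoo]|i _].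
  + by rewrite lee01 ltry.
  + by rewrite mule_ge0//= lte_mul_pinfty// ge0_fin_numE.
  + by rewrite measure_ge0/=; have [_ _ /(_ k)[]] := FP i.
Qed.

End product_measure.

(** * The law with independent blocks is dominated by the law *)

Section merged_law.
Context {d} {T : measurableType d} {R : realType} (P : probability T R).
Context {p : nat} (X : {mfun T >-> p.-tuple R}).
Variable nu : 'I_p -> {sigma_finite_measure set R -> \bar R}.
Local Open Scope ereal_scope.
Implicit Types u : {set 'I_p}.

Definition marginal_measure u :
    {sigma_finite_measure set (#|u|.-tuple R) -> \bar R} :=
  prod_measure (nu \o enum_val).
Local Notation nu_ := marginal_measure.

Lemma prod_measure_glue u B : measurable B ->
  prod_measure nu B = (nu_ u \x nu_ (finset.setC u)) (@glue R p u @^-1` B).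
Proof.
move=> mB; pose m := pushforward (nu_ u \x nu_ (finset.setC u)) (@glue R p u).
apply: (prod_measure_unique (m := m)) => // A mA.
rewrite /m/= /pushforward.
have -> : @glue R p u @^-1` box A =
    box (A \o enum_val : 'I_#|u| -> set R) `*`
    box (A \o enum_val : 'I_#|finset.setC u| -> set R).
  apply/seteqP; split => -[a b] /=.
      move=> Ax; split=> k /=.
      by have := Ax (enum_val k); rewrite -tnth_subvect subvect_glue.
    by have := Ax (enum_val k); rewrite -tnth_subvect subvectC_glue.
  move=> [Aa Ab] i; have [iu|iu] := boolP (i \in u).
    rewrite -(tnth_pad_subvect _ iu) subvect_glue.
    by rewrite -[i](enum_rankK_in iu iu) tnth_pad; exact: Aa.
  have iuc : i \in finset.setC u by rewrite inE.
  rewrite -(tnth_pad_subvect _ iuc) subvectC_glue.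
  by rewrite -[i](enum_rankK_in iuc iuc) tnth_pad; exact: Ab.
rewrite product_measure1E; [|by apply: measurable_box => k; exact: mA..].
rewrite (bigID (mem u))/=; congr (_ * _).
  by rewrite big_enum_val; apply: prod_measure_box => k; exact: mA.
rewrite (eq_bigl (mem (finset.setC u))); last by move=> i; rewrite /= inE.
by rewrite big_enum_val; apply: prod_measure_box => k; exact: mA.
Qed.

Lemma prod_measure_subvect0 u (N : set (#|u|.-tuple R)) : measurable N ->
  nu_ u N = 0 -> prod_measure nu (subvect u @^-1` N) = 0.
Proof.
move=> mN N0; rewrite (prod_measure_glue u); last first.
  by rewrite -[_ @^-1` _]setTI; exact: measurable_subvect.
rewrite (_ : _ @^-1` _ = N `*` setT).
  rewrite product_measure1E// -[RHS](mul0e (nu_ (finset.setC u) setT)).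
  by congr (_ * _).
by apply/seteqP; split => -[a b] /=; rewrite subvect_glue// => -[].
Qed.

Lemma ae_subvect u (Q : #|u|.-tuple R -> Prop) :
  (\forall a \ae nu_ u, Q a) -> \forall x \ae prod_measure nu, Q (subvect u x).
Proof.
move=> [N [mN N0 QN]]; exists (subvect u @^-1` N); split.
- by rewrite -[_ @^-1` _]setTI; exact: measurable_subvect.
- exact: prod_measure_subvect0.
- by move=> x /= Qx; exact: QN.
Qed.

Hypothesis PX_ac : distribution P X `<< prod_measure nu.

Lemma distribution_subvect_ac u : distribution P (subvect u \o X) `<< nu_ u.
Proof.
apply/null_content_dominatesP => N mN N0.
move/null_content_dominatesP : PX_ac => /(_ (subvect u @^-1` N)); apply.
  by rewrite -[_ @^-1` _]setTI; exact: measurable_subvect.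
exact: prod_measure_subvect0.
Qed.

End merged_law.

Section product_density.
Context {R : realType}.
Local Open Scope ereal_scope.
Local Notation dens := Radon_Nikodym_SigmaFinite.f.

(** The Radon-Nikodym derivatives that are nonnegative everywhere are used, so that
    Tonelli applies. *)
Lemma integral_product_density d1 d2 (T1 : measurableType d1)
    (T2 : measurableType d2) (mu1 : probability T1 R) (mu2 : probability T2 R)
    (nu1 : {sigma_finite_measure set T1 -> \bar R})
    (nu2 : {sigma_finite_measure set T2 -> \bar R}) (f : T1 * T2 -> \bar R) :
  mu1 `<< nu1 -> mu2 `<< nu2 -> measurable_fun setT f -> (forall z, 0 <= f z) ->
  \int[nu1 \x nu2]_z (f z * (dens mu1 nu1 z.1 * dens mu2 nu2 z.2)) =
  \int[mu1 \x mu2]_z f z.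
Proof.
move=> ac1 ac2 mf f0.
have mden1 : measurable_fun setT (dens mu1 nu1).
  exact: measurable_int (Radon_Nikodym_SigmaFinite.f_integrable ac1).
have mden2 : measurable_fun setT (dens mu2 nu2).
  exact: measurable_int (Radon_Nikodym_SigmaFinite.f_integrable ac2).
have den1_ge0 := Radon_Nikodym_SigmaFinite.f_ge0 ac1.
have den2_ge0 := Radon_Nikodym_SigmaFinite.f_ge0 ac2.
rewrite fubini_tonelli1; first last.
- by move=> z; rewrite mule_ge0// mule_ge0.
- apply: emeasurable_funM => //; apply: emeasurable_funM.
    exact: measurableT_comp.
  exact: measurableT_comp.
rewrite [RHS]fubini_tonelli1// /fubini_F/=.
rewrite -(Radon_Nikodym_SigmaFinite.change_of_variables ac1)//; first last.
- exact: measurable_fun_fubini_tonelli_F.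
- by move=> x; apply: integral_ge0.
apply: eq_integral => x _.
under eq_integral do rewrite muleCA muleC.
rewrite ge0_integralZr//; first last.
- by move=> y _; rewrite mule_ge0.
- by apply: emeasurable_funM => //; exact: measurableT_comp.
congr (_ * _); rewrite Radon_Nikodym_SigmaFinite.change_of_variables//.
exact: measurableT_comp.
Qed.

End product_density.

Section merge_integral.
Context {d} {T : measurableType d} {R : realType} (P : probability T R).
Context {p : nat} (X : {mfun T >-> p.-tuple R}).
Variable nu : 'I_p -> {sigma_finite_measure set R -> \bar R}.
Local Open Scope ereal_scope.
Implicit Types u : {set 'I_p}.
Local Notation mu := (distribution P X).
Local Notation mu_ u := (distribution P (subvect u \o X)).

Lemma integral_glue_merge u (f : p.-tuple R -> \bar R) :
  measurable_fun setT f -> (forall x, 0 <= f x) ->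
  \int[mu_ u \x mu_ (finset.setC u)]_z f (glue z) =
  \int[mu]_y \int[mu]_x f (merge u x y).
Proof.
move=> mf f0.
have mfg : measurable_fun setT (f \o @glue R p u).
  by apply: measurableT_comp => //; exact: measurable_glue.
rewrite fubini_tonelli2// /fubini_G.
have mfm : measurable_fun setT
    (fun z : p.-tuple R * p.-tuple R => f (merge u z.1 z.2)).
  by apply: measurableT_comp => //; exact: measurable_merge.
rewrite [RHS]ge0_integral_distribution//; first last.
- by move=> y; apply: integral_ge0 => x _; exact: f0.
- by apply: (@measurable_fun_fubini_tonelli_G _ _ _ _ _ mu _ mfm) => z; exact: f0.
rewrite [LHS]ge0_integral_distribution//; first last.
- by move=> y; apply: integral_ge0 => x _; exact: f0.
- apply: (@measurable_fun_fubini_tonelli_G _ _ _ _ _ (mu_ u) _ mfg) => z.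
  exact: f0.
apply: eq_integral => w _ /=.
rewrite ge0_integral_distribution//; last first.
  apply: (measurableT_comp mfg (g := fun x => (x, subvect (finset.setC u) (X w)))).
  by apply: measurable_fun_pair; [exact: measurable_id|exact: measurable_cst].
rewrite [RHS]ge0_integral_distribution//; last first.
  apply: measurableT_comp => //.
  by apply: measurable_merge => //; exact: measurable_cst.
by apply: eq_integral => w' _ /=; rewrite glue_subvect.
Qed.

Hypothesis PX_ac : mu `<< prod_measure nu.
Variables (M : R) (M_gt0 : (0 < M)%R).

(** Integrate the density inequality against [f]: the right-hand side is the
    integral under the law of [X], and after splitting [nu] along [u] the left-hand
    side is the integral under the product of the laws of the two subvectors. *)
Lemma merge_integral_le u :
  (\forall x \ae prod_measure nu,
      M%:E * marginal_density P nu X u (subvect u x)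
         * marginal_density P nu X (finset.setC u) (subvect (finset.setC u) x)
       <= density P nu X x) ->
  forall f : p.-tuple R -> \bar R, measurable_fun setT f -> (forall x, 0 <= f x) ->
  M%:E * \int[mu]_y \int[mu]_x f (merge u x y) <= \int[mu]_x f x.
Proof.
move=> pX_ge f mf f0.
pose dens := Radon_Nikodym_SigmaFinite.f.
have acu v := distribution_subvect_ac PX_ac v.
pose nu_ v := marginal_measure nu v.
pose q v := dens _ _ _ (mu_ v) (nu_ v).
have mq v : measurable_fun setT (q v).
  exact: measurable_int (Radon_Nikodym_SigmaFinite.f_integrable (acu v)).
have q0 v a : 0 <= q v a by exact: (Radon_Nikodym_SigmaFinite.f_ge0 (acu v)).
have mqX : measurable_fun setT (dens _ _ _ mu (prod_measure nu)).
  exact: measurable_int (Radon_Nikodym_SigmaFinite.f_integrable PX_ac).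
have qX0 x : 0 <= dens _ _ _ mu (prod_measure nu) x.
  exact: (Radon_Nikodym_SigmaFinite.f_ge0 PX_ac).
have qE v : \forall x \ae prod_measure nu,
    marginal_density P nu X v (subvect v x) = q v (subvect v x).
  apply: (ae_subvect (Q := fun a => marginal_density P nu X v a = q v a)).
  apply: filterS (ae_eq_Radon_Nikodym_SigmaFinite (acu v) measurableT).
  by move=> a /(_ I) /esym.
have qXE := ae_eq_Radon_Nikodym_SigmaFinite PX_ac measurableT.
rewrite -integral_glue_merge//.
rewrite -(integral_product_density (acu u) (acu (finset.setC u)))//; first last.
- by apply: measurableT_comp => //; exact: measurable_glue.
pose g x := f x *
  (q u (subvect u x) * q (finset.setC u) (subvect (finset.setC u) x)).
have mg : measurable_fun setT g.
  apply: emeasurable_funM => //.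
  apply: emeasurable_funM; apply: measurableT_comp => //;
  exact: measurable_subvect.
have g0 x : 0 <= g x by rewrite mule_ge0// mule_ge0.
have -> : \int[nu_ u \x nu_ (finset.setC u)]_z
    (f (glue z) * (q u z.1 * q (finset.setC u) z.2)) = \int[prod_measure nu]_x g x.
  transitivity (\int[nu_ u \x nu_ (finset.setC u)]_z g (glue z)).
    by apply: eq_integral => z _; rewrite /g subvect_glue subvectC_glue.
  have := ge0_integral_pushforward (@measurable_glue R p u)
    (nu_ u \x nu_ (finset.setC u)) measurableT mg (fun y _ => g0 y).
  rewrite preimage_setT => <-.
  apply: eq_measure_integral => A mA _.
  exact: (esym (prod_measure_glue nu u mA)).
rewrite -(Radon_Nikodym_SigmaFinite.change_of_variables PX_ac)//.
rewrite -ge0_integralZl//; last by rewrite lee_fin ltW.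
apply: ae_ge0_le_integral => //.
- by move=> x _; rewrite mule_ge0// lee_fin ltW.
- exact: measurable_funeM.
- by move=> x _; rewrite mule_ge0//.
- exact: emeasurable_funM.
near=> x => _.
have qXx : dens _ _ _ mu (prod_measure nu) x = density P nu X x.
  by near: x; apply: filterS qXE => x /(_ I).
have qux : marginal_density P nu X u (subvect u x) = q u (subvect u x).
  by near: x; exact: qE.
have qcx : marginal_density P nu X (finset.setC u) (subvect (finset.setC u) x) =
    q (finset.setC u) (subvect (finset.setC u) x).
  by near: x; exact: qE.
rewrite [leRHS](_ : _ = f x * density P nu X x); last by rewrite -qXx.
rewrite /g muleCA lee_wpmul2l// muleA -qux -qcx.
by near: x.
Unshelve. all: by end_near. Qed.

End merge_integral.

(** * Functions of subvectors and the stability of their sums *)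

Section functions_of_subvectors.
Context {d} {T : measurableType d} {R : realType} (P : probability T R).
Context {p : nat} (X : {mfun T >-> p.-tuple R}).
Implicit Types (u v : {set 'I_p}) (h g : p.-tuple R -> R).
Local Notation mu := (distribution P X).
Local Notation L2 := (L2 mu).
Local Notation ip := (ip mu).
Local Notation H := (H P X).

Definition depends_on u h := forall x y : p.-tuple R,
  (forall i, i \in u -> tnth x i = tnth y i) -> h x = h y.

(** Factorization through a subvector as a pointwise condition: [h \o pad] is a
    measurable factor. *)
Lemma HP u h : H u h <-> L2 h /\ depends_on u h.
Proof.
split=> [[L2h [g mg hE]]|[L2h hu]].
  by subst h; split=> // x y xy /=; rewrite (subvect_eq xy).
split=> //; exists (h \o @pad R p u).
  by apply: measurableT_comp; [exact: L2_measurable L2h|exact: measurable_pad].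
by apply/funext => x /=; apply: hu => i iu; rewrite tnth_pad_subvect.
Qed.

Lemma H_L2 u h : H u h -> L2 h. Proof. by move/HP => []. Qed.

Lemma subspace_H u : L2_subspace mu (H u).
Proof.
split=> [h /HP[]//||a f g /HP[L2f fu] /HP[L2g gu]].
  by apply/HP; split; [exact: L20|].
apply/HP; split=> [|x y xy]; first by apply: L2D => //; exact: L2Z.
by rewrite !fctE (fu _ _ xy) (gu _ _ xy).
Qed.

Lemma complete_H u : L2_complete mu (H u).
Proof.
move=> s Hs cs; have L2s n : L2 (s n) := H_L2 (Hs n).
have [f [L2f sf fs]] := L2_limit L2s cs; exists f => //.
apply/HP; split=> // x y xy; apply: fs => n.
by have /HP[_] := Hs n; apply.
Qed.

Lemma H_subset u v : v \subset u -> H v `<=` H u.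
Proof.
move=> /fintype.subsetP vu h /HP[L2h hv]; apply/HP; split=> // x y xy.
by apply: hv => i /vu; exact: xy.
Qed.

(** A non-recursive form of [H0]: orthogonality is required to all of [H v], not
    only to [H0 v].  That the two agree is [H0_orthH], which needs the
    decomposition. *)
Definition orthH u : set (p.-tuple R -> R) := [set h | H u h /\
  forall v, v \proper u -> forall g, H v g -> ip h g = 0].

Lemma subspace_orthH u : L2_subspace mu (orthH u).
Proof.
have sH := subspace_H u; split=> [h [/H_L2]//||a f g [Hf fu] [Hg gu]].
  by split; [case: sH|move=> *; exact: ip0l].
have [L2f L2g] := (H_L2 Hf, H_L2 Hg).
split=> [|v vu k Hk]; first by case: sH => _ _; exact.
have L2k := H_L2 Hk.
by rewrite ipDl ?ipZl ?(fu v) ?(gu v) ?mulr0 ?addr0//; exact: L2Z.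
Qed.

Lemma complete_orthH u : L2_complete mu (orthH u).
Proof.
move=> s As cs; have Hs n : H u (s n) by have [] := As n.
have [f Hf sf] := complete_H Hs cs; exists f => //; split=> // v vu g Hg.
apply: (fast_cvg_ip _ (H_L2 Hf) (H_L2 Hg) sf) => n; first exact: H_L2 (Hs n).
by have [_ /(_ v vu g Hg)] := As n.
Qed.

(** Stability of the sums of the [orthH v]: such a sum is direct, and its
    members depend continuously on it. *)
Definition sums_stable := forall F : {set {set 'I_p}}, exists2 c : R, 0 < c &
  forall e, (forall v, v \in F -> orthH v (e v)) ->
  c * \sum_(v in F) ip (e v) (e v) <=
    ip (\sum_(v in F) e v) (\sum_(v in F) e v).

Section lower_bound.
Context (M : R) (M_gt0 : 0 < M).
Hypothesis merge_le : forall u (f : p.-tuple R -> \bar R),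
  measurable_fun setT f -> (forall x, (0 <= f x)%E) ->
  (M%:E * \int[mu]_y \int[mu]_x f (merge u x y) <= \int[mu]_x f x)%E.

(** The merged law is dominated by [mu] up to a constant, so that [h] is square
    integrable for it; Tonelli then gives the sections. *)
Lemma ae_L2_merge u h : L2 h -> \forall y \ae mu, L2 (fun x => h (merge u x y)).
Proof.
move=> /L2P[mh hoo]; pose f x := (h x ^+ 2)%:E.
have mf : measurable_fun setT f by apply/measurable_EFinP; exact: measurable_funX.
have f0 x : (0 <= f x)%E by rewrite lee_fin sqr_ge0.
have mfm : measurable_fun setT
    (fun z : p.-tuple R * p.-tuple R => f (merge u z.1 z.2)).
  by apply: measurableT_comp => //; exact: measurable_merge.
have intoo : (\int[mu]_y \int[mu]_x f (merge u x y) < +oo)%E.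
  rewrite -(lte_pmul2l (z := M%:E)) ?lte_fin// gt0_muley ?lte_fin//.
  exact: le_lt_trans (merge_le u mf f0) _.
have /(integrable_ae measurableT) : mu.-integrable setT
    (fun y => \int[mu]_x f (merge u x y))%E.
  apply/integrableP; split.
    by apply: (@measurable_fun_fubini_tonelli_G _ _ _ _ _ mu _ mfm) => z; exact: f0.
  under eq_integral do rewrite gee0_abs ?integral_ge0//.
  exact: intoo.
apply: filterS => y /(_ I) yfin; apply/L2P; split.
  apply: measurableT_comp => //.
  by apply: measurable_merge => //; exact: measurable_cst.
by rewrite ltey_eq yfin.
Qed.

(** For almost every [y] the function [x |-> \sum_v e v (merge u x y)] is a sum of
    elements of the [H (u :&: v)], and [u :&: v] is strictly included in [u]; hence
    it is orthogonal to [h]. *)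
Lemma orthH_lower_bound u (F : pred {set 'I_p}) h
    (e : {set 'I_p} -> p.-tuple R -> R) :
  orthH u h -> (forall v, F v -> H v (e v) /\ ~~ (u \subset v)) ->
  M * ip h h <= ip (h + \sum_(v | F v) e v) (h + \sum_(v | F v) e v).
Proof.
move=> [Hh hu] eF; have L2h := H_L2 Hh; have /HP[_ h_u] := Hh.
set g := \sum_(v | F v) e v.
have L2g : L2 g by apply: L2_sum => v /eF[/H_L2].
have L2hg := L2D L2h L2g.
pose f x := ((h x + g x) ^+ 2)%:E.
have f0 x : (0 <= f x)%E by rewrite lee_fin sqr_ge0.
have mf : measurable_fun setT f.
  by apply/measurable_EFinP; apply: measurable_funX; exact: L2_measurable L2hg.
rewrite -lee_fin [leRHS]ipxxE//; apply: le_trans (merge_le u mf f0).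
rewrite EFinM lee_pmul2l ?lte_fin//.
have mfm : measurable_fun setT
    (fun z : p.-tuple R * p.-tuple R => f (merge u z.1 z.2)).
  by apply: measurableT_comp => //; exact: measurable_merge.
have -> : (ip h h)%:E = (\int[mu]_y (cst (ip h h)%:E) y)%E.
  rewrite integral_cst// [X in (_ * X)%E](_ : _ = 1%E) ?mule1//.
  exact: probability_setT.
apply: ae_ge0_le_integral => //.
- by move=> y _; rewrite lee_fin ip_ge0.
- by move=> y _; apply: integral_ge0 => x _; exact: f0.
- by apply: (@measurable_fun_fubini_tonelli_G _ _ _ _ _ mu _ mfm) => z; exact: f0.
have : \forall y \ae mu, forall v, F v -> L2 (fun x => e v (merge u x y)).
  apply: filter_forall => v; have [Fv|nFv] := boolP (F v); last exact: nearW.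
  have [Hv _] := eF v Fv.
  by apply: filterS (ae_L2_merge u (H_L2 Hv)) => y L2y _.
apply: filterS => y L2e _ /=.
pose k v x := e v (merge u x y).
have Hk v : F v -> H (u :&: v) (k v).
  move=> Fv; apply/HP; split; first exact: L2e.
  move=> x x' xx'; have [/HP[_ ev] _] := eF v Fv; apply: ev => i iv.
  by rewrite !tnth_mktuple; case: ifPn => // iu; apply: xx'; rewrite inE iu.
have hk v : F v -> ip h (k v) = 0.
  move=> Fv; apply: (hu (u :&: v)); last exact: Hk.
  have [_ nuv] := eF v Fv.
  rewrite finset.properEneq finset.subsetIl andbT.
  by apply: contraNneq nuv => <-; exact: finset.subsetIr.
have L2k : L2 (\sum_(v | F v) k v) by apply: L2_sum => v /Hk /H_L2.
have -> : (\int[mu]_x f (merge u x y) =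
    (ip (h + \sum_(v | F v) k v) (h + \sum_(v | F v) k v))%:E)%E.
  rewrite ipxxE; last exact: L2D.
  apply: eq_integral => x _; congr (_ ^+ 2)%:E; congr (_ + _).
    by apply: h_u => i iu; rewrite tnth_mktuple iu.
  by rewrite /g !fct_sumE.
rewrite lee_fin ipDD// (ipC mu h (\sum_(v | F v) k v)) ip_suml//.
by rewrite big1 ?mulr0 ?addr0 ?lerDl ?ip_ge0// => v Fv; rewrite ipC hk.
Qed.

(** Induction on the family: the lower bound controls one member [e u] of
    maximal cardinality, which no other member of the family contains; the rest
    of the sum is the whole sum minus [e u], so that it is controlled as well. *)
Lemma orthH_stable : sums_stable.
Proof.
move=> F; have [n] := ubnP #|F|; elim: n F => // n IH F Fn.
have [->|[v0 v0F]] := set_0Vmem F.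
  exists 1 => // e _; rewrite !big_set0 mulr0; exact: ip_ge0.
have [u /= uF0 umax] := arg_maxnP (fun v : {set 'I_p} => #|v|) v0F.
have uF : u \in F by exact: uF0.
have [|c c0 cP] := IH (F :\ u).
  by rewrite -ltnS; apply: leq_trans Fn; rewrite (cardsD1 u F) uF.
(* With [s] the whole sum and [r = s - e u]: [||e u||^2 <= ||s||^2 / M], and
   [||r||^2 <= 2 ||s||^2 + 2 ||e u||^2 <= (2 + 2 / M) ||s||^2]. *)
exists (M^-1 + (2 + 2 / M) / c)^-1.
  by rewrite invr_gt0 addr_gt0 ?invr_gt0// divr_gt0// addr_gt0// divr_gt0.
move=> e eF.
have L2e v : v \in F -> L2 (e v) by move=> /eF[/H_L2].
have eD : \sum_(v in F) e v = e u + \sum_(v in F :\ u) e v.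
  by rewrite (big_setD1 u).
rewrite (big_setD1 u)//= eD; set r := \sum_(v in F :\ u) e v.
have L2u := L2e u uF.
have L2r : L2 r by apply: L2_sum => v /setD1P[_ /L2e].
have rP : c * \sum_(v in F :\ u) ip (e v) (e v) <= ip r r.
  by apply: cP => v /setD1P[_ /eF].
have uP : M * ip (e u) (e u) <= ip (e u + r) (e u + r).
  apply: orthH_lower_bound => [|v /setD1P[vu vF]]; first exact: eF.
  have [Hv _] := eF v vF; split=> //; apply/negP => uv.
  have := umax v vF; rewrite leqNgt => /negP; apply.
  by rewrite proper_card// finset.properEneq eq_sym vu.
set S := \sum_(v in _) _ in rP *; set s := ip (e u + r) _ in uP *.
set a := ip (e u) _ in uP *.
have L2s := L2D L2u L2r.
have rs : ip r r <= 2 * s + 2 * a.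
  have -> : r = (e u + r) - e u by rewrite addrAC subrr add0r.
  exact: ip_sqrB_le.
rewrite mulrC ler_pdivrMr; last first.
  by rewrite addr_gt0 ?invr_gt0// divr_gt0// addr_gt0// divr_gt0.
have aM : a <= M^-1 * s by rewrite ler_pdivlMl.
have Sc : S <= c^-1 * (2 * s + 2 * a) by rewrite ler_pdivlMl//; exact: le_trans rP rs.
rewrite mulrDr lerD//; first by rewrite mulrC.
apply: le_trans Sc _.
have -> : s * ((2 + 2 / M) / c) = c^-1 * (2 * s + 2 * (M^-1 * s)) by ring.
by rewrite ler_pM2l ?invr_gt0// lerD2l ler_pM2l.
Qed.

End lower_bound.

End functions_of_subvectors.

(** * The decomposition and the constraints *)

Section decomposition.
Context {d} {T : measurableType d} {R : realType} (P : probability T R).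
Context {p : nat} (X : {mfun T >-> p.-tuple R}).
Implicit Types (u v w : {set 'I_p}) (h g : p.-tuple R -> R).
Local Notation mu := (distribution P X).
Local Notation L2 := (L2 mu).
Local Notation ip := (ip mu).
Local Notation H := (H P X).
Local Notation H0 := (H0 P X).
Local Notation orthH := (orthH P X).

Lemma integrable_law (f : p.-tuple R -> R) : mu.-integrable setT (EFin \o f) ->
  P.-integrable setT (EFin \o f \o X).
Proof.
move=> /integrableP[mf foo]; apply/integrableP; split.
  exact: measurableT_comp.
rewrite -(ge0_integral_distribution X (f := abse \o (EFin \o f)))//.
- exact: measurableT_comp.
- by move=> y; exact: abse_ge0.
Qed.

Lemma integral_law (f : p.-tuple R -> R) (D : set (p.-tuple R)) : measurable D ->
  mu.-integrable setT (EFin \o f) ->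
  (\int[P]_(t in X @^-1` D) (f (X t))%:E = \int[mu]_(x in D) (f x)%:E)%E.
Proof.
move=> mD intf; have /measurable_int mf := intf.
have intfX : P.-integrable (X @^-1` D) (EFin \o f \o X).
  apply: integrableS (integrable_law intf) => //.
  by rewrite -[_ @^-1` _]setTI; exact: measurable_funPT.
by rewrite (integral_pushforward _ mf intfX).
Qed.

Lemma innerE h g : L2 h -> L2 g -> inner P X h g = (ip h g)%:E.
Proof.
move=> L2h L2g; rewrite ipE// /inner unlock.
rewrite -[in LHS](preimage_setT X).
exact: (@integral_law (fun x => h x * g x)) (L2_integrableM L2h L2g).
Qed.

Lemma orthH_sub_H0 u h : orthH u h -> H0 u h.
Proof.
move=> [Hh hu]; rewrite H0E; split=> // v vu g; rewrite H0E => -[Hg _].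
by rewrite innerE ?(hu v)//; [exact: H_L2 Hh|exact: H_L2 Hg].
Qed.

Section with_stable_sums.
Hypothesis stable : sums_stable P X.

(** Project [h] on the sum of the [orthH v], [v] strictly included in [u].  By
    induction this sum contains every such [H v], so that the remainder is in
    [orthH u]. *)
Lemma H_decomposition u h : H u h -> exists2 e : {set 'I_p} -> p.-tuple R -> R,
  (forall v, orthH v (e v)) & h = \sum_(v : {set 'I_p} | v \subset u) e v.
Proof.
have [n] := ubnP #|u|; elim: n u h => // n IH u h un Hh.
pose F : {set {set 'I_p}} := [set v : {set 'I_p} | v \proper u]%SET.
have FE v : (v \in F) = (v \proper u) by rewrite inE.
have [c c0 cP] := stable F.
have orth0 v : orthH v 0 by have [] := subspace_orthH P X v.
pose K := [set f | exists2 e : {set 'I_p} -> p.-tuple R -> R,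
  (forall v, v \in F -> orthH v (e v)) & f = \sum_(v in F) e v].
have sK : L2_subspace mu K.
  by apply: subspace_sums => v _; exact: subspace_orthH.
have cK : L2_complete mu K.
  apply: (complete_sums c0) => // v _; first exact: subspace_orthH.
  exact: complete_orthH.
have [_ [e eF ->] hK] := complete_projection sK cK (H_L2 Hh).
set k := \sum_(v in F) e v in hK.
have Hk : H u k.
  apply: subspace_sum => [|v]; first exact: subspace_H.
  move=> vF; have [Hev _] := eF v vF; apply: H_subset Hev.
  by move: vF; rewrite FE => /proper_sub.
have hk : orthH u (h - k).
  split; first by apply: subspaceB => //; exact: subspace_H.
  move=> v vu g Hg; apply: hK.
  have [|e' e'P ->] := IH v g _ Hg.
    by rewrite -ltnS; apply: leq_trans un; exact: proper_card.
  exists (fun w => if w \subset v then e' w else 0).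
    by move=> w _; case: ifP.
  rewrite -big_mkcondr/=; apply: eq_bigl => w; rewrite FE.
  by apply/idP/andP => [wv|[]//]; split=> //; exact: sub_proper_trans vu.
exists (fun v => if v == u then h - k else if v \in F then e v else 0).
  move=> v; case: eqP => [->//|_]; case: ifPn => // vF; exact: eF.
rewrite (bigD1 u)//= eqxx -[LHS](subrK k); congr (_ + _).
apply: eq_big => v; first by rewrite FE finset.properEneq andbC.
by move=> vF; rewrite vF ifN//; move: vF; rewrite FE => /proper_neq.
Qed.

Lemma H0_orthH u : H0 u = orthH u.
Proof.
apply/seteqP; split=> h; last exact: orthH_sub_H0.
rewrite H0E => -[Hh hu]; split=> // v vu g Hg.
have [e eP ->] := H_decomposition Hg.
have L2e w : L2 (e w) by have [/H_L2] := eP w.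
have L2h := H_L2 Hh.
rewrite ipC ip_suml// big1// => w wv; apply: EFin_inj.
rewrite ipC -innerE// (hu w)//; first exact: sub_proper_trans vu.
exact: orthH_sub_H0.
Qed.

End with_stable_sums.

Lemma L2_indic (A : set (p.-tuple R)) : measurable A -> L2 \1_A.
Proof.
move=> mA; apply/L2P; split; first exact: measurable_indic.
rewrite (eq_integral (fun x => (\1_A x)%:E)); last first.
  by move=> x _; rewrite indicE expr2 -natrM mulnb andbb.
by rewrite integral_indic// setIT ltey_eq fin_num_measure.
Qed.

Lemma measurable_preimage_subvect u (B : set (#|u|.-tuple R)) : measurable B ->
  measurable (@subvect R p u @^-1` B).
Proof. by rewrite -[_ @^-1` _]setTI; exact: measurable_subvect. Qed.

Lemma H_indic u (B : set (#|u|.-tuple R)) : measurable B ->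
  H u (\1_(subvect u @^-1` B)).
Proof.
move=> mB; apply/HP; split.
  by apply: L2_indic; exact: measurable_preimage_subvect.
move=> x y xy; rewrite !indicE; congr (_%:R); congr nat_of_bool.
by apply/idP/idP; rewrite !inE/= (subvect_eq xy).
Qed.

Lemma ip_indic h (A : set (p.-tuple R)) : measurable A -> L2 h ->
  (ip h \1_A)%:E = (\int[mu]_(x in A) (h x)%:E)%E.
Proof.
move=> mA L2h; rewrite ipE//; last exact: L2_indic.
rewrite [RHS]integral_mkcond.
apply: eq_integral => x _; rewrite patchE indicE.
by case: ifP => xA; rewrite ?mulr1 ?mulr0.
Qed.

(** The integral of [h] vanishes over the set where it is positive. *)
Lemma H_ae_le0 w h : H w h ->
  (forall B, measurable B -> ip h \1_(subvect w @^-1` B) = 0) ->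
  \forall x \ae mu, h x <= 0.
Proof.
move=> Hh h0; have /HP[L2h hw] := Hh.
pose B := @pad R p w @^-1` [set x | 0 < h x].
have mh := L2_measurable L2h.
have mpos : measurable [set x | 0 < h x].
  rewrite (_ : mkset _ = h @^-1` `]0, +oo[).
    by rewrite -[_ @^-1` _]setTI; exact: mh.
  by apply/seteqP; split => x /=; rewrite in_itv/= andbT.
have mB : measurable B.
  by rewrite -[B]setTI; exact: measurable_pad.
have BE : subvect w @^-1` B = [set x | 0 < h x].
  apply/seteqP; split => x /=; rewrite /B/= (hw _ x)// => i iw;
  by rewrite tnth_pad_subvect.
have : (\int[mu]_(x in [set x | (0 < h x)%R]) `|(h x)%:E| = 0)%E.
  rewrite (_ : 0%E = (ip h \1_(subvect w @^-1` B))%:E); last by rewrite h0.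
  rewrite BE ip_indic//.
  by apply: eq_integral => x; rewrite inE/= => hx; rewrite ger0_norm// ltW.
have mhE : measurable_fun [set x | 0 < h x] (fun x => (h x)%:E).
  by apply/measurable_EFinP; exact: measurable_funTS.
move/(ae_eq_integral_abs mu mpos mhE); apply: filterS => x hx.
rewrite leNgt; apply/negP => hx0.
by have [hx00] := hx hx0; rewrite hx00 ltxx in hx0.
Qed.

(** A null conditional expectation only gives orthogonality to indicators.  The
    projection [k] of [h] on [H w] is then orthogonal to these indicators too, among
    which are those of its own positive and negative sets: [k] is null almost
    everywhere. *)
Lemma cond_expectation0P u w h : H u h ->
  is_cond_expectation P (subvect w \o X) (h \o X) (cst 0) <->
  forall g, H w g -> ip h g = 0.
Proof.
move=> Hh; have L2h := H_L2 Hh.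
have hP B : measurable B ->
    (\int[P]_(t in (subvect w \o X) @^-1` B) (h (X t))%:E =
    (ip h \1_(subvect w @^-1` B))%:E)%E.
  move=> mB; have mwB := measurable_preimage_subvect mB.
  by rewrite ip_indic// -(integral_law mwB)//; exact: L2_integrable.
split; last first.
  move=> hw; split.
  - exact/integrable_law/L2_integrable.
  - exact: integrable0.
  - move=> B mB; rewrite preimage_cst; case: ifP => _.
      by exists setT => //; rewrite preimage_setT setTI.
    by exists set0 => //; rewrite preimage_set0 setI0.
  - move=> _ [B mB <-]; rewrite integral0 setTI hP// hw//.
    exact: H_indic.
move=> [_ _ _ hw] g Hg.
have cH : L2_complete mu (H w) by exact: complete_H.
have [k Hk hk] := complete_projection (subspace_H P X w) cH L2h.
have L2k := H_L2 Hk; have L2g := H_L2 Hg.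
have k0 B : measurable B -> ip k \1_(subvect w @^-1` B) = 0.
  move=> mB; have HB := H_indic mB; have L2B := H_L2 HB.
  have := hk _ HB; rewrite ipBl// => /eqP; rewrite subr_eq0 => /eqP <-.
  apply: EFin_inj; rewrite -hP// -hw ?integral0//.
  by exists B => //; rewrite setTI.
have k_le0 := H_ae_le0 Hk k0.
have Nk_le0 : \forall x \ae mu, (- k) x <= 0.
  rewrite -scaleN1r; apply: (@H_ae_le0 w).
    by apply: subspaceZ => //; exact: subspace_H.
  move=> B mB; rewrite ipZl ?k0 ?mulr0//; exact: H_L2 (H_indic mB).
have k00 : k = cst 0 %[ae mu].
  apply: filterS2 k_le0 Nk_le0 => x kx Nkx _; apply/le_anti.
  by rewrite kx/= -oppr_le0.
have := hk g Hg; rewrite ipBl// (ip_ae L2k _ L2g k00); last exact: L20.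
by rewrite ip0l subr0.
Qed.

End decomposition.

(** * Feasible families and uniqueness *)

Section solutions.
Context {d} {T : measurableType d} {R : realType} (P : probability T R).
Context {p : nat} (X : {mfun T >-> p.-tuple R}).
Implicit Types (u v w : {set 'I_p}) (h g : p.-tuple R -> R).
Implicit Types e : {set 'I_p} -> p.-tuple R -> R.
Local Notation mu := (distribution P X).
Local Notation L2 := (L2 mu).
Local Notation ip := (ip mu).
Local Notation H := (H P X).
Local Notation orthH := (orthH P X).

(** A strict subset of [u] misses some [i] in [u], hence is included in [u :\ i]:
    orthogonality to the [H (u :\ i)] is orthogonality to all smaller [H v]. *)
Lemma feasibleP e : feasible P X e <-> forall u, orthH u (e u).
Proof.
split=> [[He ce] u|oe]; last first.
  split=> [u|u _ i iu]; first by have [] := oe u.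
  have [Hu hu] := oe u; apply/(cond_expectation0P _ Hu) => g; apply: hu.
  by rewrite properD1.
split=> // v /properP[vu [i iu iv]] g Hg.
have u0 : u != finset.set0 by apply/set0Pn; exists i.
have /(cond_expectation0P _ (He u)) := ce u u0 i iu; apply.
apply: H_subset Hg; apply/fintype.subsetP => j jv; rewrite !inE.
by rewrite (fintype.subsetP vu j jv) andbT; apply: contraNneq iv => <-.
Qed.

Lemma ip_law h : L2 h -> (ip h h)%:E = 'E_P[fun t => (h (X t) ^+ 2)%R]%E.
Proof.
move=> L2h; rewrite ipxxE// unlock ge0_integral_distribution//.
- by apply/measurable_EFinP; apply: measurable_funX; exact: L2_measurable L2h.
- by move=> x; rewrite lee_fin sqr_ge0.
Qed.

Lemma ip_law_eq0 h : L2 h -> (\forall t \ae P, h (X t) = 0) -> ip h h = 0.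
Proof.
move=> L2h h0; apply: EFin_inj; rewrite ip_law// unlock.
have mh := L2_measurable L2h.
rewrite (ae_eq_integral (cst 0%E))//; first by rewrite integral0.
- by apply/measurable_EFinP; apply: measurable_funX; exact: measurableT_comp.
- by apply: filterS h0 => t -> _; rewrite expr0n.
Qed.

Section with_stable_sums.
Hypothesis stable : sums_stable P X.

Lemma orthH_sum_eq0 e : (forall u, orthH u (e u)) ->
  ip (\sum_u e u) (\sum_u e u) = 0 -> forall u, e u = cst 0 %[ae mu].
Proof.
move=> oe e0 u; have L2e v : L2 (e v) by have [/H_L2] := oe v.
apply: ip_eq0 => //; have [c c0 /(_ e (fun v _ => oe v))] := stable finset.setT.
have sumT (V : nmodType) (f : {set 'I_p} -> V) :
  \sum_(v in finset.setT) f v = \sum_v f v by apply: eq_bigl => v; rewrite inE.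
rewrite !sumT e0 pmulr_rle0// => s0.
apply/eqP; rewrite eq_le ip_ge0 andbT; apply: le_trans s0.
by rewrite (bigD1 u)//= lerDl sumr_ge0// => v _; exact: ip_ge0.
Qed.

Lemma orthH_unique eta e e' : L2 eta ->
  (forall u, orthH u (e u)) -> (forall u, orthH u (e' u)) ->
  ip (eta - \sum_u e u) (eta - \sum_u e u) = 0 ->
  ip (eta - \sum_u e' u) (eta - \sum_u e' u) = 0 ->
  eq_family P X e e'.
Proof.
move=> L2eta oe oe' e0 e'0 u.
have L2s f : (forall v, orthH v (f v)) -> L2 (\sum_v f v).
  by move=> ofv; apply: L2_sum => v _; have [/H_L2] := ofv v.
have od v : orthH v (e v - e' v) by apply: subspaceB => //; exact: subspace_orthH.
have : ip (\sum_v (e v - e' v)) (\sum_v (e v - e' v)) = 0.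
  apply/eqP; rewrite eq_le ip_ge0 andbT.
  have -> : \sum_v (e v - e' v) = (eta - \sum_v e' v) - (eta - \sum_v e v).
    by rewrite sumrB; apply/funext => x; rewrite !fctE; ring.
  have L2d := L2B L2eta (L2s _ oe); have L2d' := L2B L2eta (L2s _ oe').
  by apply: le_trans (ip_sqrB_le L2d' L2d) _; rewrite e0 e'0 !mulr0 addr0.
move/(orthH_sum_eq0 od) => /(_ u); apply: filterS => x /(_ I) eex _.
by apply/eqP; rewrite -subr_eq0; apply/eqP.
Qed.

End with_stable_sums.

End solutions.

Theorem proposition1 (R : realType) (d : measure_display)
  (T : measurableType d) (P : probability T R)
  (p : nat) (p_ge1 : (1 <= p)%N) (X : {mfun T >-> p.-tuple R})
  (nu : 'I_p -> {sigma_finite_measure set R -> \bar R})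
  (PX_ac : distribution P X `<< prod_measure nu)
  (M : R) (M_gt0 : 0 < M) (M_le1 : M <= 1)
  (pX_ge : forall u : {set 'I_p},
    \forall x \ae prod_measure nu,
      (M%:E * marginal_density P nu X u (subvect u x)
         * marginal_density P nu X (finset.setC u) (subvect (finset.setC u) x)
       <= density P nu X x)%E)
  (eta : p.-tuple R -> R) (eta_L2 : eta \in Lfun (distribution P X) 2%:E) :
  exists eta_ : {set 'I_p} -> p.-tuple R -> R,
    [/\ hierarchical_decomposition P X eta eta_,
        (forall e, hierarchical_decomposition P X eta e -> eq_family P X e eta_),
        solution P X eta eta_ &
        (forall e, solution P X eta e -> eq_family P X e eta_)].
Proof.
have merge_le u := merge_integral_le PX_ac M_gt0 (pX_ge u).
have stable := orthH_stable M_gt0 merge_le.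
have L2eta : L2 (distribution P X) eta by [].
have Heta : H P X finset.setT eta.
  by apply/HP; split=> // x y xy; congr eta; apply: eq_from_tnth => i; apply: xy.
have [eta_ oeta etaE] := H_decomposition stable Heta.
have {}etaE : eta = \sum_u eta_ u.
  by rewrite {1}etaE; apply: eq_bigl => u; rewrite finset.subsetT.
pose defect (e : {set 'I_p} -> p.-tuple R -> R) := eta - \sum_u e u.
have L2defect e : (forall u, orthH P X u (e u)) -> L2 (distribution P X) (defect e).
  move=> oe; apply: L2B => //; apply: L2_sum => u _; exact: H_L2 (oe u).1.
have objE e : (forall u, orthH P X u (e u)) ->
    objective P X eta e = (ip (distribution P X) (defect e) (defect e))%:E.
  move=> oe; rewrite ip_law; last exact: L2defect.
  congr expectation; apply/funext => w.
  by rewrite /defect !fctE fct_sumE.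
have eta0 : ip (distribution P X) (defect eta_) (defect eta_) = 0.
  by rewrite /defect -etaE subrr ip0l.
have unique e : (forall u, orthH P X u (e u)) ->
    ip (distribution P X) (defect e) (defect e) = 0 -> eq_family P X e eta_.
  by move=> oe e0; apply: (orthH_unique stable L2eta).
have H0E' := H0_orthH stable.
exists eta_; split.
- split=> [u|]; first by rewrite H0E'.
  by apply: aeW => w; rewrite {1}etaE fct_sumE.
- move=> e [He eE]; have oe u : orthH P X u (e u) by rewrite -H0E'.
  apply: unique => //; apply: ip_law_eq0; first exact: L2defect.
  apply: filterS eE => w etaw.
  by rewrite /defect !fctE fct_sumE etaw subrr.
- split; first exact/feasibleP.
  move=> e /feasibleP oe.
  by rewrite !objE// eta0 lee_fin ip_ge0.
- move=> e [/feasibleP oe emin]; apply: unique => //.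
  have := emin eta_ ((feasibleP P X eta_).2 oeta).
  rewrite !objE// eta0 lee_fin => e0.
  by apply/eqP; rewrite eq_le e0 ip_ge0.
Qed.
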